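(* Let $F:\Omega\subset\mathbb R^n\to\mathbb R^n$ ($\Omega$ open) be given by an evaluation procedure, let $x^\ast$ be an isolated root of $F$, and let $\lozenge_{x^\ast}F$ be bijective on a ball $\mathcal D=B(x^\ast,\bar R)\subset\Omega$, with metric regularity constant $c>0$ on $\mathcal D$. Let $\gamma_F$ be a second-order constant valid on $\mathcal D$, let $0<R\le\min(\bar R,\frac1{c\gamma_F})$ and $\rho=\frac R3$. Then on $B(x^\ast,\rho)$ the Newton step is defined in both the tangent and the secant mode (i.e. $\lozenge_{\mathring x}F(x)=0$, respectively $\lozenge_{\check x}^{\hat x}F(x)=0$, has at least one root for all $\mathring x$, respectively $\check x,\hat x$, in $B(x^\ast,\rho)$) and maps back into $B(x^\ast,\rho)$. The thus definable Newton iterations, $x_{k+1}=N(x_k)$ in tangent mode with $x_0\in B(x^\ast,\rho)$ and $x_{k+1}=N(x_k,x_{k-1})$ in secant mode with $x_0,x_1\in B(x^\ast,\rho)$, converge at least linearly to $x^\ast$.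
   Context: All norms are infinity norms; $B(x,r)$ is the open ball; $\frac1{c\gamma_F}=+\infty$ if $\gamma_F=0$. Evaluation procedure. $F:\Omega\subset\mathbb R^n\to\mathbb R^m$ (here $m=n$) is evaluated by a finite straight-line program: $v_{1-n},\dots,v_0$ are the components of $x$; for $i=1,\dots,l$ each $v_i$ is either $v_i=v_j+v_k$, or $v_i=|v_j|$, or $v_i=\varphi_i(v_j)$ with indices $j,k<i$, where each smooth univariate elemental $\varphi_i$ is defined on an open subset of $\mathbb R$ containing all values $v_j(x)$, $x\in\Omega$, and is differentiable there with locally Lipschitz derivative; the last $m$ values form $F(x)$. (Multiplications by constants are smooth univariate elementals; subtraction, product and quotient are rewritten using these, $u\cdot w=\tfrac14[(u+w)^2-(u-w)^2]$ and the reciprocal.) Secant model. For $\check x,\hat x\in\Omega$ put $\check v_i=v_i(\check x)$, $\hat v_i=v_i(\hat x)$, $\mathring v_i=(\check v_i+\hat v_i)/2$, $\mathring x=(\check x+\hat x)/2$. For $\Delta x\in\mathbb R^n$ define increments recursively: for the inputs, $\Delta v_{1-n},\dots,\Delta v_0$ are the components of $\Delta x$; $\Delta v_i=\Delta v_j+\Delta v_k$ if $v_i=v_j+v_k$; $\Delta v_i=c_{ij}\Delta v_j$ if $v_i=\varphi_i(v_j)$, with $c_{ij}=(\check v_i-\hat v_i)/(\check v_j-\hat v_j)$ if $\check v_j\ne\hat v_j$ and $c_{ij}=\varphi_i'(\mathring v_j)$ otherwise; $\Delta v_i=|\mathring v_j+\Delta v_j|-\mathring v_i$ if $v_i=|v_j|$.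 The vector of the last $m$ increments is $\Delta F(\check x,\hat x;\Delta x)$, and $\lozenge_{\check x}^{\hat x}F(x)=\tfrac12(F(\check x)+F(\hat x))+\Delta F(\check x,\hat x;x-\mathring x)$ for $x\in\mathbb R^n$. Tangent model: $\lozenge_{\mathring x}F=\lozenge_{\mathring x}^{\mathring x}F$. Second-order constant: $\gamma_F$ is valid on a set $U$ if it is obtained, for some convex $K$ with $U\subset K\subset\Omega$, by these recurrences with all quantities finite: $\beta_{x_i}=1,\gamma_{x_i}=0$ for inputs; $\beta_v=\beta_u+\beta_w$, $\gamma_v=\gamma_u+\gamma_w$ if $v=u+w$; $\beta_v=\beta_u$, $\gamma_v=\gamma_u$ if $v=|u|$; $\beta_v=\beta_uL_K(\varphi)$, $\gamma_v=L_K(\varphi)\gamma_u+L_K(\varphi')\beta_u^2$ if $v=\varphi(u)$, where $L_K(\varphi)=\sup_{x\in K}|\varphi'(u(x))|$ and $L_K(\varphi')$ is the Lipschitz constant of $\varphi'$ on $u(K)$; $\gamma_F$ is the maximum over components. Bijectivity on $\mathcal D$ means that $\lozenge_{x^\ast}F|_{\mathcal D}:\mathcal D\to\lozenge_{x^\ast}F(\mathcal D)$ is a bijection. Metric regularity with constant $c>0$: for all $x\in\mathcal D$, $y\in\lozenge_{x^\ast}F(\mathcal D)$, $\|x-(\lozenge_{x^\ast}F|_{\mathcal D})^{-1}(y)\|\le c\|\lozenge_{x^\ast}F(x)-y\|$. Newton operator: $N(\mathring x)$ is a point of $\arg\min\{\|x-\mathring x\|:\lozenge_{\mathring x}F(x)=0\}$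 (tangent mode), $N(\hat x,\check x)$ is a point of $\arg\min\{\|x-\tfrac12(\hat x+\check x)\|:\lozenge_{\check x}^{\hat x}F(x)=0\}$ (secant mode); any minimizer may be chosen. At least linear convergence to $x^\ast$: there is $q\in(0,1)$ with $\|x_{k+1}-x^\ast\|\le q\|x_k-x^\ast\|$ for all iteration steps. *)

(* Defs.v *)
From HB Require Import structures.
From mathcomp Require Import all_boot all_order all_algebra.
From mathcomp Require Import all_classical all_reals all_analysis.

Set Implicit Arguments.
Unset Strict Implicit.
Unset Printing Implicit Defensive.

Import Order.TTheory GRing.Theory Num.Theory.
Import numFieldNormedType.Exports.

Local Open Scope classical_set_scope.
Local Open Scope ring_scope.

(* The norm of 'rV[R]_n is the library's mx_norm, i.e. the infinity norm, and
   [ball] is the corresponding open ball. *)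

(* Values are numbered from 0: the n inputs v_(1-n), ..., v_0 are at positions
   0, ..., n-1, and the i-th instruction (i >= 0) of the program computes the
   value at position n + i. *)
Inductive instr (R : realType) : Type :=
| VAdd of nat & nat
| VAbs of nat
| VElem of set R & (R -> R) & nat. (* domain, elemental, argument *)

Section Evaluation.
Context {R : realType} {n : nat}.
Implicit Types (P : seq (instr R)) (x : 'rV[R]_n).

Definition trace (T : Type) (step : seq T -> instr R -> T) (s : seq T)
    (P : seq (instr R)) : seq T :=
  foldl (fun s ins => rcons s (step s ins)) s P.

Definition inputs x : seq R := [seq x ord0 i | i <- enum 'I_n].

(* A trace of P has length n + size P, so its last n entries start at
   position size P. *)
Definition outputs P (s : seq R) : 'rV[R]_n :=
  \row_(i < n) s`_(size P + i).

Definition value_step (s : seq R) (ins : instr R) : R :=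
  match ins with
  | VAdd j k => s`_j + s`_k
  | VAbs j => `|s`_j|
  | VElem _ phi j => phi s`_j
  end.

Definition values P x : seq R := trace value_step (inputs x) P.

Definition eval_prog P x : 'rV[R]_n := outputs P (values P x).

Definition C11_elemental (D : set R) (phi : R -> R) : Prop :=
  [/\ open D,
      forall t, D t -> derivable phi t 1 &
      forall t, D t ->
        exists2 U, nbhs t U & [lipschitz derive1 phi s | s in U `&` D]].

Definition well_formed P (Omega : set 'rV[R]_n) : Prop :=
  forall i, (i < size P)%N ->
  match nth (VAbs R 0) P i with
  | VAdd j k => (j < n + i)%N /\ (k < n + i)%N
  | VAbs j => (j < n + i)%N
  | VElem D phi j =>
      [/\ (j < n + i)%N, C11_elemental D phi &
          forall x, Omega x -> D (values P x)`_j]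
  end.

Definition evaluation_procedure P (Omega : set 'rV[R]_n)
    (F : 'rV[R]_n -> 'rV[R]_n) : Prop :=
  well_formed P Omega /\ (forall x, Omega x -> F x = eval_prog P x).

End Evaluation.

Section SecantModel.
Context {R : realType} {n : nat}.
Implicit Types (P : seq (instr R)) (xc xh x dx : 'rV[R]_n).

(* vc and vh are all the values at the two reference points; s holds the
   increments computed so far, so that size s is the current position. *)
Definition increment_step (vc vh s : seq R) (ins : instr R) : R :=
  let mid j := (vc`_j + vh`_j) / 2 in
  let i := size s in
  match ins with
  | VAdd j k => s`_j + s`_k
  | VAbs j => `|mid j + s`_j| - mid i
  | VElem _ phi j =>
      (if vc`_j != vh`_j then (vc`_i - vh`_i) / (vc`_j - vh`_j)
       else derive1 phi (mid j)) * s`_j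
  end.

Definition increments P xc xh dx : seq R :=
  trace (increment_step (values P xc) (values P xh)) (inputs dx) P.

Definition DeltaF P xc xh dx : 'rV[R]_n := outputs P (increments P xc xh dx).

Definition secant_model P xc xh x : 'rV[R]_n :=
  2^-1 *: (eval_prog P xc + eval_prog P xh)
  + DeltaF P xc xh (x - 2^-1 *: (xc + xh)).

Definition tangent_model P xm x : 'rV[R]_n := secant_model P xm xm x.

End SecantModel.

Section SecondOrderConstant.
Context {R : realType} {n : nat}.
Implicit Types (P : seq (instr R)) (K Omega U : set 'rV[R]_n).

Definition slopes (phi : R -> R) (u : 'rV[R]_n -> R) K : set R :=
  [set `|derive1 phi (u x)| | x in K].

Definition lip_bounds (phi : R -> R) (u : 'rV[R]_n -> R) K : set R :=
  [set k : R | 0 <= k /\ k.-lipschitz_(u @` K) (derive1 phi)].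

(* [sup] and [inf] are those of the real line: they are the intended suprema
   and Lipschitz constants only under [finite_constants] below. *)
Definition bound_step P K (s : seq (R * R)) (ins : instr R) : R * R :=
  let beta j := (nth (0, 0) s j).1 in
  let gamma j := (nth (0, 0) s j).2 in
  match ins with
  | VAdd j k => (beta j + beta k, gamma j + gamma k)
  | VAbs j => (beta j, gamma j)
  | VElem _ phi j =>
      let u x := (values P x)`_j in
      let L := sup (slopes phi u K) in
      let L' := inf (lip_bounds phi u K) in
      (beta j * L, L * gamma j + L' * beta j ^+ 2)
  end.

Definition bounds P K : seq (R * R) :=
  trace (bound_step P K) (nseq n (1, 0)) P.

Definition gammaF P K : R :=
  \big[Num.max/0]_(i < n) (nth (0, 0) (bounds P K) (size P + i)).2.

Definition finite_constants P K : Prop :=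
  forall i, (i < size P)%N ->
  match nth (VAbs R 0) P i with
  | VElem _ phi j =>
      let u x := (values P x)`_j in
      has_ubound (slopes phi u K) /\ lip_bounds phi u K !=set0
  | _ => True
  end.

Definition second_order_constant P Omega U (gamma : R) : Prop :=
  exists K : set 'rV[R]_n,
    [/\ convex_set K, U `<=` K, K `<=` Omega, finite_constants P K &
        gamma = gammaF P K].

End SecondOrderConstant.

Section Newton.
Context {R : realType} {n : nat}.
Implicit Types (P : seq (instr R)) (f : 'rV[R]_n -> 'rV[R]_n).
Implicit Types (x xm xc xh : 'rV[R]_n).

Definition bijection_onto_image f (D : set 'rV[R]_n) : Prop := set_bij D (f @` D) f.

Definition metric_regular f (D : set 'rV[R]_n) (c : R) : Prop :=
  forall x y, D x -> (f @` D) y ->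
    `|x - 'pinv_(fun=> 0) D f y| <= c * `|f x - y|.

Definition zeros f : set 'rV[R]_n := [set x | f x = 0].

Definition nearest (A : set 'rV[R]_n) (p : 'rV[R]_n) : set 'rV[R]_n :=
  [set x | A x /\ forall z, A z -> `|x - p| <= `|z - p|].

(* Newton steps are set-valued, since any minimizer may be chosen. *)
Definition newton_tangent P xm : set 'rV[R]_n :=
  nearest (zeros (tangent_model P xm)) xm.

Definition newton_secant P xh xc : set 'rV[R]_n :=
  nearest (zeros (secant_model P xc xh)) (2^-1 *: (xh + xc)).

Definition linearly_convergent (u : nat -> 'rV[R]_n) (xs : 'rV[R]_n) : Prop :=
  exists q : R, 0 < q < 1 /\ forall k, `|u k.+1 - xs| <= q * `|u k - xs|.

End Newton.

(* Main.v *)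
(* All secant and tangent models are uniformly Lipschitz, and two of them, with base
   points (c, h) and (c', h'), differ at x by at most
     gamma (|c - c'| |x - h| + |h - h'| |x - c'|).
   Compared with the tangent model G at the root, metric regularity turns this into
   e <= c gamma ((a + b) e + a b) for the distance e of a root of a model to the root
   of F, where a and b are the distances of its base points; hence e <= (3 a / r) b
   for every root within r.  For existence, G is bi-Lipschitz, so it is open by
   invariance of domain and covers the ball of radius r / (3 c); composing a nearby
   model with the inverse of G gives a map near the identity, which has a zero by
   Brouwer's theorem.  The latter is obtained from a cubical Sperner lemma. *)

Require Import Defs.
From HB Require Import structures.
From mathcomp Require Import all_boot all_order all_algebra.
From mathcomp Require Import all_classical all_reals all_analysis.
From mathcomp Require Import ring lra.

Import Order.TTheory GRing.Theory Num.Theory.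
Import numFieldNormedType.Exports.

Set Implicit Arguments.
Unset Strict Implicit.
Unset Printing Implicit Defensive.

Local Open Scope ring_scope.

(** * A cubical Sperner lemma *)

(** The hypotheses make the tangent model at the root injective on the ball, with Lipschitz inverse
    on its image; they do not say that the image is a neighbourhood of 0, and a piecewise linear map
    need not be differentiable, so the inverse function theorem does not apply. This gap is what
    invariance of domain fills. The combinatorial lemma is stated for cubes, where the cup product
    over F_2 takes the place of counting fully labelled simplices, so that no triangulation of the
    grid is required. The third in the radius: with [c * gamma * r <= 1] the error estimate becomes
    [(r - a - b) * e <= a * b], and [a, b < r / 3] keeps [r - a - b] above [r / 3] and the resulting
    factor [3 * a / r] below 1. *)

Section Cup.
Context {n : nat}.
Implicit Types (q : 'I_n -> nat) (A B : {set 'I_n}) (f : ('I_n -> nat) -> 'F_2).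

Definition set_coord q a k : 'I_n -> nat := fun i => if i == a then k else q i.
Definition step q a := set_coord q a (q a).+1.

(* The value, on the cube with lowest corner [q] and directions [A], of the cup
   product over F_2 of the coboundaries of the 0-cochains [fs]. *)
Fixpoint cup (fs : seq (('I_n -> nat) -> 'F_2)) q A : 'F_2 :=
  if fs is f :: fs' then
    \sum_(a in A) (f (step q a) - f q) * cup fs' (step q a) (A :\ a)
  else 1.

Lemma addF2 (x : 'F_2) : x + x = 0.
Proof. by rewrite -mulr2n -mulr_natl pchar_Fp_0 // mul0r. Qed.

Lemma oppF2 (x : 'F_2) : - x = x.
Proof. by apply/eqP; rewrite eq_sym -addr_eq0 addF2. Qed.

Lemma stepC q a b : step (step q a) b = step (step q b) a.
Proof.
apply/funext => i; rewrite /step /set_coord.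
have [->//|ba] /= := eqVneq b a.
by have [->|//] := eqVneq i b; rewrite (negbTE ba).
Qed.

(** Every unordered pair of distinct directions is counted twice, which is 0 in F_2. *)
Lemma sum_sym_F2 (B : {set 'I_n}) (phi : 'I_n -> 'I_n -> 'F_2) :
  (forall a b, phi a b = phi b a) ->
  \sum_(b in B) \sum_(a in B :\ b) phi a b = 0.
Proof.
move=> phiC.
have E b : b \in B -> \sum_(a in B :\ b) phi a b =
   \sum_(a in B | (a < b)%N) phi a b + \sum_(a in B | (b < a)%N) phi a b.
  move=> _; rewrite (bigID (fun a : 'I_n => (a < b)%N)) /=.
  congr (_ + _); apply: eq_bigl => a; rewrite !inE -val_eqE /=;
    by case: ltngtP => //=; rewrite ?andbF ?andbT.
rewrite (eq_bigr _ E) big_split /=.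
suff -> : \sum_(b in B) \sum_(a in B | (b < a)%N) phi a b =
  \sum_(b in B) \sum_(a in B | (a < b)%N) phi a b by rewrite addF2.
rewrite (exchange_big_dep (fun a => a \in B)) /=; last by move=> ? ? _ /andP[].
apply: eq_bigr => b bB; apply: eq_big => a; first by rewrite bB.
by move=> _; rewrite phiC.
Qed.

(** A cup product of coboundaries is a cocycle: over F_2 the two sides together sum it over all
    facets of the cube. In the induction the terms symmetric in two directions cancel in pairs, and
    the induction hypothesis matches the others. *)
Lemma cup_cocycle fs q B :
  \sum_(b in B) cup fs (step q b) (B :\ b) = \sum_(b in B) cup fs q (B :\ b).
Proof.
elim: fs q B => [|f fs IH] q B //=.
have setD1C a b : B :\ a :\ b = B :\ b :\ a.
  by apply/setP => i; rewrite !inE andbCA.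
have swap (phi : 'I_n -> 'I_n -> 'F_2) :
  \sum_(b in B) \sum_(a in B :\ b) phi a b = \sum_(b in B) \sum_(a in B :\ b) phi b a.
  rewrite (exchange_big_dep (fun a => a \in B)) /=; last first.
    by move=> ? ? _; rewrite !inE => /andP[].
  by apply: eq_bigr => b bB; apply: eq_bigl => a; rewrite !inE bB andbT andbC eq_sym.
transitivity (\sum_(b in B) \sum_(a in B :\ b)
   f (step q b) * cup fs (step (step q b) a) (B :\ b :\ a)).
  apply/eqP; rewrite -subr_eq0 oppF2 -big_split /=.
  under eq_bigr do rewrite -big_split /=.
  rewrite (_ : \sum_(b in B) _ = \sum_(b in B) \sum_(a in B :\ b)
     f (step (step q b) a) * cup fs (step (step q b) a) (B :\ b :\ a)).
    by apply/eqP; apply: sum_sym_F2 => a b; rewrite stepC setD1C.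
  apply: eq_bigr => b _; apply: eq_bigr => a _.
  by rewrite mulrBl -addrA oppF2 addF2 addr0.
under [RHS]eq_bigr do under eq_bigr do rewrite mulrBl.
under [RHS]eq_bigr do rewrite big_split /=.
rewrite big_split /=.
rewrite [X in _ = _ + X](_ : _ = 0); last first.
  under eq_bigr do rewrite sumrN -mulr_sumr IH oppF2 mulr_sumr.
  by apply: sum_sym_F2 => a b; rewrite setD1C.
rewrite addr0 [RHS]swap.
apply: eq_bigr => b bB.
rewrite -mulr_sumr IH mulr_sumr; apply: eq_bigr => a _.
by rewrite setD1C.
Qed.

Definition in_cube q A (r : 'I_n -> nat) :=
  forall i, if i \in A then (q i <= r i <= (q i).+1)%N else r i == q i.

Lemma in_cube_refl q A : in_cube q A q.
Proof. by move=> i; case: (i \in A); rewrite ?leqnn ?leqnSn /=. Qed.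

Lemma in_cube_step q A a : a \in A -> in_cube q A (step q a).
Proof.
move=> aA i; rewrite /step /set_coord; have [->|_] := eqVneq i a.
  by rewrite aA leqnSn leqnn.
exact: in_cube_refl.
Qed.

Lemma in_subcube q A a r : a \in A ->
  in_cube (step q a) (A :\ a) r -> in_cube q A r.
Proof.
move=> aA cr i; have := cr i; rewrite !inE /step /set_coord.
have [->|_] //= := eqVneq i a.
by rewrite aA => /eqP ->; rewrite leqnSn leqnn.
Qed.

(** The coboundary of a label constant on the cube vanishes on its edges, and every term of the
    expanded [cup] contains such a factor. Contrapositively, a nonzero cup product certifies a cube
    on which no label is constant. *)
Lemma cup_const f fs q A : f \in fs ->
  (forall r s, in_cube q A r -> in_cube q A s -> f r = f s) ->
  cup fs q A = 0.
Proof.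
elim: fs q A => // g fs IH q A; rewrite inE => /orP[/eqP <-|ffs] fc /=.
  apply: big1 => a aA; rewrite (fc _ q) ?subrr ?mul0r //.
    exact: in_cube_step.
  exact: in_cube_refl.
apply: big1 => a aA; rewrite IH ?mulr0 // => r s cr cs.
by apply: fc; exact: in_subcube aA _.
Qed.

Fixpoint grid_sum p (l : seq 'I_n) (h : ('I_n -> nat) -> 'F_2) q : 'F_2 :=
  if l is a :: l' then \sum_(k < p) grid_sum p l' h (set_coord q a k) else h q.

Lemma set_coordC q a b j k : a != b ->
  set_coord (set_coord q a j) b k = set_coord (set_coord q b k) a j.
Proof.
move=> ab; apply/funext => i; rewrite /set_coord.
by have [->|//] := eqVneq i b; rewrite eq_sym (negbTE ab).
Qed.


Lemma set_coordK q a j k : set_coord (set_coord q a j) a k = set_coord q a k.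
Proof. by apply/funext => i; rewrite /set_coord; case: eqVneq. Qed.

Lemma grid_sum_set p l a k h q : a \notin l ->
  grid_sum p l h (set_coord q a k) = grid_sum p l (fun r => h (set_coord r a k)) q.
Proof.
elim: l q => //= b l IH q; rewrite inE negb_or => /andP[ab al].
by apply: eq_bigr => j _; rewrite -IH // set_coordC.
Qed.

Lemma grid_sum_sum p l I (s : seq I) (P : pred I) (h : I -> ('I_n -> nat) -> 'F_2) q :
  grid_sum p l (fun r => \sum_(i <- s | P i) h i r) q =
  \sum_(i <- s | P i) grid_sum p l (h i) q.
Proof.
elim: l q => //= a l IH q; rewrite exchange_big /=.
by apply: eq_bigr => k _; rewrite IH.
Qed.

(** Sums in different directions commute; with [a] innermost, telescoping along [a] can be done at
    each fixed [r]. *)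
Lemma grid_sum_innermost p l a h q : uniq l -> a \in l ->
  grid_sum p l h q =
  grid_sum p (rem a l) (fun r => \sum_(k < p) h (set_coord r a k)) q.
Proof.
elim: l q => //= b l IH q /andP[bl ul]; rewrite inE eq_sym.
have [ba _|ba /= al] := eqVneq b a; last first.
  by apply: eq_bigr => k _; rewrite IH.
rewrite -ba grid_sum_sum; apply: eq_bigr => k _.
by rewrite grid_sum_set.
Qed.

Lemma grid_sum_neq0 p l h q : grid_sum p l h q != 0 ->
  exists r, [/\ forall i, i \in l -> (r i < p)%N,
               forall i, i \notin l -> r i = q i & h r != 0].
Proof.
elim: l q => [|a l IH] q /= nz; first by exists q.
have [k /IH[r [rl rnl hr]]] : exists k : 'I_p, grid_sum p l h (set_coord q a k) != 0.
  apply/existsP; apply: contraNT nz => /existsPn nz.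
  by apply/eqP; apply: big1 => k _; apply/eqP; rewrite -[_ == _]negbK nz.
exists r; split=> // i; rewrite inE.
  have [->|_ /rl//] := eqVneq i a; have [/rl//|al _] := boolP (a \in l).
  by rewrite rnl // /set_coord eqxx.
by rewrite negb_or => /andP[ia il]; rewrite rnl // /set_coord (negbTE ia).
Qed.

Lemma grid_sum0 p l q : grid_sum p l (fun=> 0) q = 0.
Proof. by elim: l q => //= a l IH q; apply: big1. Qed.

(* The cup product of [fs] is closed, so multiplying it by the coboundary of [f]
   gives a telescoping sum over the grid.  Only the face [q a = p] contributes:
   on the others a label is constant. *)
Lemma grid_sum_cup p (f : 'I_n -> ('I_n -> nat) -> 'F_2) l q :
  (forall i q, q i = 0 -> f i q = 0) -> (forall i q, q i = p -> f i q = 1) ->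
  uniq l ->
  grid_sum p l (fun r => cup [seq f i | i <- l] r [set i in l]) q = 1.
Proof.
move=> f0 f1; elim: l q => [|a l IH] q //; rewrite [uniq _]/= => /andP[al ul].
set A := [set i in a :: l]; set fs := [seq f i | i <- l].
pose g b r := f a r * cup fs r (A :\ b).
have Aa : A :\ a = [set i in l].
  by apply/setP => i; rewrite !inE; have [->|] //= := eqVneq; rewrite (negbTE al).
(* In the part with factor [f a r], [cup_cocycle] moves the cup product of [fs] back to the corner
   [r]; what remains are differences of [g b] across opposite facets. *)
rewrite (_ : (fun r => cup _ r A) =
    fun r => \sum_(b in A) (g b (step r b) - g b r)); last first.
  apply/funext => r /=; under eq_bigr do rewrite mulrBl.
  by rewrite 2!sumrB -[in LHS]mulr_sumr cup_cocycle mulr_sumr.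
rewrite grid_sum_sum.
have ulL : uniq (a :: l) by rewrite /= al.
move EL : (a :: l) ulL => L ulL; rewrite (bigD1 a) /=; last by rewrite !inE eqxx.
have tele b r : \sum_(k < p) (g b (step (set_coord r b k) b) - g b (set_coord r b k))
   = g b (set_coord r b p) - g b (set_coord r b 0).
  rewrite -(telescope_sumr (fun k => g b (set_coord r b k))) // big_mkord.
  by apply: eq_bigr => k _; rewrite /step set_coordK {2}/set_coord eqxx.
rewrite [X in _ + X]big1 ?addr0 => [|b /andP[bA ba]].
  rewrite (@grid_sum_innermost p L a) // -EL ?mem_head //= eqxx.
  rewrite -[RHS](IH (set_coord q a p)) // grid_sum_set //; congr grid_sum.
  apply/funext => r; rewrite tele /g f1 ?f0 ?mul0r ?mul1r ?subr0 ?Aa //;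
    by rewrite /set_coord eqxx.
have bl : b \in l by move: bA; rewrite !inE (negbTE ba).
rewrite (@grid_sum_innermost p L b) // -?EL; last by rewrite inE bl orbT.
rewrite -[RHS](grid_sum0 p (rem b (a :: l)) q); congr grid_sum.
apply/funext => r; rewrite tele /g.
have fbs : f b \in fs by exact: map_f.
have const k : k = 0%N \/ k = p -> cup fs (set_coord r b k) (A :\ b) = 0.
  move=> k0p; apply: (cup_const fbs) => s t /(_ b) + /(_ b).
  rewrite !inE eqxx /= /set_coord eqxx => /eqP sb /eqP tb.
  by case: k0p => k0p; rewrite k0p in sb tb; [rewrite !f0|rewrite !f1].
by rewrite !const ?mulr0 ?subr0; [|left|right].
Qed.

End Cup.

(** By [grid_sum_cup] the cup products of all unit cubes add up to 1 in F_2, so one of them is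
    nonzero; by [cup_const] both values of every label occur on that cube. *)
Lemma kuhn_cube n p (lab : 'I_n -> ('I_n -> nat) -> bool) :
  (forall i q, q i = 0%N -> ~~ lab i q) -> (forall i q, q i = p -> lab i q) ->
  exists q, (forall i, (q i < p)%N) /\
    forall i, exists r s, [/\ forall j, (q j <= r j <= (q j).+1)%N,
      forall j, (q j <= s j <= (q j).+1)%N, lab i r & ~~ lab i s].
Proof.
move=> lab0 lab1; pose f i q : 'F_2 := (lab i q)%:R.
have total : grid_sum p (enum 'I_n)
    (fun r => cup [seq f i | i <- enum 'I_n] r [set: 'I_n]) (fun=> 0%N) = 1.
  rewrite -[RHS](@grid_sum_cup n p f (enum 'I_n) (fun=> 0%N)) ?enum_uniq //.
  - congr grid_sum; apply/funext => r; congr cup.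
    by apply/setP => i; rewrite !inE mem_enum.
  - by move=> i q /lab0/negbTE fi; rewrite /f fi.
  - by move=> i q /lab1 fi; rewrite /f fi.
have [q [qp _ nz]] : exists r, [/\ forall i, i \in enum 'I_n -> (r i < p)%N,
    forall i, i \notin enum 'I_n -> r i = 0%N &
    cup [seq f i | i <- enum 'I_n] r [set: 'I_n] != 0].
  by apply: (@grid_sum_neq0 _ p _ _ (fun=> 0%N)); rewrite total oner_neq0.
exists q; split=> [i|i]; first by rewrite qp ?mem_enum.
apply: contrapT => no; move: nz; rewrite (cup_const (f := f i)) ?eqxx //.
  by rewrite map_f ?mem_enum.
move=> r s cr cs; apply: contrapT => frs; apply: no.
have box t : in_cube q [set: 'I_n] t -> forall j, (q j <= t j <= (q j).+1)%N.
  by move=> ct j; have := ct j; rewrite inE.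
move: frs; rewrite /f; case lr: (lab i r); case ls: (lab i s) => // _.
  by exists r, s; rewrite lr ls; split=> //; exact: box.
by exists s, r; rewrite lr ls; split=> //; exact: box.
Qed.

(** * Maps close to the identity have a zero *)

Local Open Scope classical_set_scope.
Local Open Scope ring_scope.

Section Brouwer.
Context {R : realType}.

Lemma lipschitz_continuous (V W : normedModType R) (C : R) (f : V -> W) :
  (forall x y, `|f x - f y| <= C * `|x - y|) -> continuous f.
Proof.
move=> fC x; apply/cvgrPdist_le => e e0.
have C0 : 0 < `|C| + 1 by rewrite ltr_pwDr.
near=> y; apply: (le_trans (fC x y)).
apply: (@le_trans _ _ ((`|C| + 1) * `|x - y|)).
  by rewrite ler_wpM2r // (le_trans (ler_norm C)) // lerDl.
rewrite mulrC -ler_pdivlMr //.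
near: y; apply: cvgr_dist_le; [exact: cvg_id|by rewrite divr_gt0].
Unshelve. all: by end_near. Qed.

Lemma rV_coord_le n (x : 'rV[R]_n) i : `|x ord0 i| <= `|x|.
Proof.
rewrite [leRHS]/Num.Def.normr/= mx_normrE.
by apply/bigmax_geP; right => /=; exists (ord0, i).
Qed.

Lemma rV_norm_le n (x : 'rV[R]_n) e : 0 <= e ->
  (forall i, `|x ord0 i| <= e) -> `|x| <= e.
Proof.
move=> e0 xe; rewrite [leLHS]/Num.Def.normr/= mx_normrE.
by apply: bigmax_le => // -[j i] _ /=; rewrite ord1.
Qed.

Lemma rV_norm_neq0 n (x : 'rV[R]_n) : x != 0 -> exists i, x ord0 i != 0.
Proof.
move=> x0; apply: contrapT => nx; move/eqP: x0; apply.
apply/rowP => i; rewrite mxE; apply/eqP; apply: contrapT => xi.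
by apply: nx; exists i; apply/negP.
Qed.

Lemma dist_continuous (V : normedModType R) (a : V) :
  continuous (fun x : V => `|x - a|).
Proof.
apply: (@lipschitz_continuous _ _ 1) => x y.
by rewrite mul1r (le_trans (ler_dist_dist _ _)) // opprB addrA subrK.
Qed.

Lemma closed_ball_compact n (a : 'rV[R]_n) rho :
  compact [set x : 'rV[R]_n | `|x - a| <= rho].
Proof.
apply: bounded_closed_compact.
  exists (`|a| + rho); split; first exact: num_real.
  move=> M ltM x /= xa; apply: (le_trans _ (ltW ltM)).
  have := ler_normD (x - a) a; rewrite subrK; lra.
rewrite (_ : [set x | _] = (fun x => `|x - a|) @^-1` [set t | t <= rho]) //.
by apply: closed_comp; [move=> x _; exact: dist_continuous|exact: closed_le].
Qed.

(* [i] is labelled by the sign of the [i]-th coordinate of [h]: a cube on which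
   no label is constant lies near a zero. *)
Lemma near_id_zero n (a : 'rV[R]_n) rho (h : 'rV[R]_n -> 'rV[R]_n) :
  0 < rho -> continuous h ->
  (forall x, `|x - a| <= rho -> `|h x - (x - a)| <= rho) ->
  exists2 x, `|x - a| <= rho & h x = 0.
Proof.
move=> rho0 hc hid; apply: contrapT => nz.
have hnz x : `|x - a| <= rho -> h x != 0.
  by move=> xa; apply/eqP => hx; apply: nz; exists x.
pose P (d : R) (x : 'rV[R]_n) := exists i,
  (forall y, `|y - x| <= d -> 0 < h y ord0 i) \/
  (forall y, `|y - x| <= d -> h y ord0 i < 0).
(* A Lebesgue number: by compactness one radius [d] serves all centres [x]. *)
have : \forall d \near 0^'+, forall x, `|x - a| <= rho -> P d x.
  have /compact_near_coveringP : compact [set x : 'rV[R]_n | `|x - a| <= rho].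
    exact: closed_ball_compact.
  apply => x /= xa.
  have [i hi] := rV_norm_neq0 (hnz x xa).
  have hi0 : 0 < `|h x ord0 i| by rewrite normr_gt0.
  have /nbhs_ballP[e /= e0 he] : \forall y \near x, `|h x - h y| < `|h x ord0 i|.
    by have /cvgrPdist_lt := hc x; apply.
  have e20 : 0 < e / 2 by rewrite divr_gt0.
  exists (ball x (e / 2), [set d | d < e / 2]) => /=.
    split; first exact: nbhsx_ballx.
    by apply: nbhs_right_lt.
  move=> [y d] /= [+ de]; rewrite -ball_normE /= => xy.
  have yd z : `|z - y| <= d -> `|h x ord0 i - h z ord0 i| < `|h x ord0 i|.
    move=> zy; have : ball x e z.
      rewrite -ball_normE /=; rewrite (splitr e).
      have := ler_distD y x z; rewrite (distrC y z); lra.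
    move=> /he; apply: le_lt_trans.
    by have := rV_coord_le (h x - h z) i; rewrite !mxE.
  exists i; move: hi; rewrite neq_lt => /orP[hi|hi]; [right|left] => z /yd.
    rewrite (ltr0_norm hi) => /ltr_normlP[]; lra.
  rewrite (gtr0_norm hi) => /ltr_normlP[]; lra.
move=> Pd; have [d d0 {Pd}Pd] : exists2 d, 0 < d & forall x, `|x - a| <= rho -> P d x.
  have [e /= e0 ee] := Pd.
  exists (e / 2); first by rewrite divr_gt0.
  apply: ee; last by rewrite /= divr_gt0.
  by rewrite /= sub0r normrN gtr0_norm ?divr_gt0 // ltr_pdivrMr // ltr_pMr // ltr1n.
pose p := (Num.truncn (2 * rho / d)).+1.
have p0 : 0 < p%:R :> R by rewrite ltr0n.
have pd : 2 * rho / p%:R <= d.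
  by rewrite ler_pdivrMr // [leRHS]mulrC -ler_pdivrMr //; apply/ltW; exact: truncnS_gt.
pose pt (q : 'I_n -> nat) : 'rV[R]_n :=
  \row_i (a ord0 i - rho + 2 * rho / p%:R * (q i)%:R).
have ptE q i : (pt q - a) ord0 i = 2 * rho / p%:R * (q i)%:R - rho.
  by rewrite !mxE; ring.
have pt_in q : (forall i, (q i <= p)%N) -> `|pt q - a| <= rho.
  move=> qp; apply: rV_norm_le => [|i]; first exact: ltW.
  have := qp i; rewrite -(ler_nat R) => qi.
  have pi : 2 * rho / p%:R * (q i)%:R <= 2 * rho.
    rewrite -mulrA -[leRHS]mulr1 ler_pM2l ?mulr_gt0 //.
    by rewrite mulrC ler_pdivrMr // mul1r.
  have pi0 : 0 <= 2 * rho / p%:R * (q i)%:R.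
    by rewrite mulr_ge0 // divr_ge0 // ?mulr_ge0 // ltW.
  rewrite ptE ler_norml; lra.
(* The labels on the two extreme faces are forced, as [kuhn_cube] requires. There [hid] gives [h]
   the matching weak sign, so a label determines a weak sign everywhere. *)
pose lab i q := (q i == p) || ((q i != 0%N) && (0 <= h (pt q) ord0 i)).
have hcoord q i : (forall j, (q j <= p)%N) ->
    `|h (pt q) ord0 i - (2 * rho / p%:R * (q i)%:R - rho)| <= rho.
  move=> /pt_in/hid; apply: le_trans; rewrite -ptE.
  by have := rV_coord_le (h (pt q) - (pt q - a)) i; rewrite !mxE.
have lab_ge0 q i : (forall j, (q j <= p)%N) -> lab i q -> 0 <= h (pt q) ord0 i.
  move=> qp /orP[/eqP qi|/andP[]//].
  have := hcoord q i qp; rewrite qi mulfVK ?gt_eqF // => /ler_normlP[]; lra.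
have lab_le0 q i : (forall j, (q j <= p)%N) -> ~~ lab i q -> h (pt q) ord0 i <= 0.
  move=> qp; rewrite negb_or negb_and negbK -ltNge => /andP[_ /orP[/eqP qi|/ltW//]].
  have := hcoord q i qp; rewrite qi mulr0 => /ler_normlP[]; lra.
have [i q qi|i q /eqP qi|q [qp box]] := @kuhn_cube n p lab.
- by rewrite /lab qi.
- by rewrite /lab qi.
have near_pt r : (forall j, (q j <= r j <= (q j).+1)%N) ->
    (forall j, (r j <= p)%N) /\ `|pt r - pt q| <= d.
  move=> qr; split=> [j|]; first by have /andP[_ /leq_trans->] := qr j.
  apply: rV_norm_le => [|j]; first exact: ltW.
  rewrite !mxE (_ : _ - _ = 2 * rho / p%:R * ((r j)%:R - (q j)%:R)); last by ring.
  have /andP[qj rj] := qr j.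
  rewrite -natrB // ger0_norm; last by rewrite mulr_ge0 // divr_ge0 // ?mulr_ge0 // ltW.
  apply: (le_trans _ pd); rewrite ger_pMr ?divr_gt0 ?mulr_gt0 //.
  by rewrite -[1]/(1%:R) ler_nat leq_subLR addn1.
have [i Pi] := Pd (pt q) (pt_in q (fun i => ltnW (qp i))).
have [r [s [/near_pt[rp rd] /near_pt[sp sd] lr ls]]] := box i.
have hr := lab_ge0 _ _ rp lr; have hs := lab_le0 _ _ sp ls.
case: Pi => Pi; first by have := Pi _ sd; rewrite ltNge hs.
by have := Pi _ rd; rewrite ltNge hr.
Qed.

End Brouwer.

(** * Bi-Lipschitz maps are open *)

Section Invariance.
Context {R : realType}.

(* McShane's extension, coordinate by coordinate, of the inverse of [G]. *)
Lemma lipschitz_left_inverse n (D : set 'rV[R]_n) (G : 'rV[R]_n -> 'rV[R]_n) c :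
  0 <= c -> D !=set0 ->
  (forall x x', D x -> D x' -> `|x - x'| <= c * `|G x - G x'|) ->
  exists E : 'rV[R]_n -> 'rV[R]_n,
    (forall y z, `|E y - E z| <= c * `|y - z|) /\ (forall x, D x -> E (G x) = x).
Proof.
move=> c0 [x0 Dx0] Gc.
have Gc1 i x x' : D x -> D x' -> x ord0 i - x' ord0 i <= c * `|G x - G x'|.
  move=> Dx Dx'; apply: (le_trans _ (Gc _ _ Dx Dx')).
  by apply: le_trans (ler_norm _) _; have := rV_coord_le (x - x') i; rewrite !mxE.
pose S y i := [set x ord0 i + c * `|G x - y| | x in D].
have S0 y i : S y i !=set0 by exists (x0 ord0 i + c * `|G x0 - y|); exists x0.
have Slb y i : has_lbound (S y i).
  exists (x0 ord0 i - c * `|G x0 - y|) => _ [x Dx <-].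
  have := Gc1 i x0 x Dx0 Dx.
  have := ler_wpM2l c0 (ler_distD y (G x0) (G x)); rewrite (distrC y) mulrDr; lra.
pose E y : 'rV[R]_n := \row_i inf (S y i).
have Ele y z i : E y ord0 i <= E z ord0 i + c * `|y - z|.
  rewrite -lerBlDr !mxE; apply: lb_le_inf => // _ [x Dx <-].
  rewrite lerBlDr.
  apply: (@le_trans _ _ (x ord0 i + c * `|G x - y|)).
    by apply: ge_inf => //; exists x.
  have := ler_wpM2l c0 (ler_distD z (G x) y); rewrite (distrC z) mulrDr; lra.
(* In the maximum norm [E] inherits the Lipschitz constant [c] of its coordinates without loss. *)
exists E; split=> [y z|x Dx].
  apply: rV_norm_le => [|i]; first by rewrite mulr_ge0.
  have := Ele y z i; have := Ele z y i; rewrite (distrC z) => h1 h2.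
  rewrite mxE [X in _ + X]mxE; rewrite ler_norml; lra.
apply/rowP => i; rewrite mxE; apply/le_anti/andP; split.
  by apply: ge_inf => //; exists x => //; rewrite subrr normr0 mulr0 addr0.
apply: lb_le_inf => // _ [x' Dx' <-].
have := Gc1 i x x' Dx Dx'; rewrite (distrC (G x)); lra.
Qed.

Lemma eq_modn_close d a b : (a %% d = b %% d)%N ->
  `|a%:R - b%:R| < d%:R :> R -> a = b.
Proof.
wlog ab : a b / (a <= b)%N => [th md|md].
  have [/th|/ltnW ba] := leqP a b; first exact.
  by rewrite distrC => /th -> //.
rewrite distrC -natrB // normr_nat ltr_nat => ltd.
have : (d %| b - a)%N by rewrite -eqn_mod_dvd // md.
move=> /dvdn_leq; case: (posnP (b - a)) => [/eqP|_ /(_ isT)].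
  by rewrite subn_eq0 => ba _; apply/eqP; rewrite eqn_leq ab.
by rewrite leqNgt ltd.
Qed.

(* A face of the sphere has dimension [n - 1], so a grid of mesh [1 / N] on it has
   too few cells to reach the [N ^ n] points of a grid around 0. *)
Lemma sphere_image_avoid n (E : 'rV[R]_n -> 'rV[R]_n) c p eps delta :
  0 <= c -> (forall y z, `|E y - E z| <= c * `|y - z|) -> 0 < eps -> 0 < delta ->
  exists2 w, `|w| < delta & forall y, `|y - p| = eps -> E y <> w.
Proof.
case: n => [|n] in E p * => c0 Ec eps0 delta0.
  exists 0 => [|y]; first by rewrite normr0.
  have -> : y - p = 0 by apply/rowP => -[].
  by rewrite normr0 => e0; rewrite -e0 ltxx in eps0.
apply: contrapT => nE.
have {nE}sol w : `|w| < delta -> exists y, `|y - p| = eps /\ E y = w.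
  move=> wd; apply: contrapT => ny; apply: nE; exists w => // y yp Ey.
  by apply: ny; exists y.
(* Preimages at most [2 * eps / N] apart have images at most [2 * c * eps / N] apart, so grid
   indices, spaced by [delta / N], then differ by less than [M.+1] and are told apart by their
   residues. *)
pose M := Num.truncn (2 * c * eps / delta).
have Mgt : 2 * c * eps / delta < M.+1%:R by exact: truncnS_gt.
(* Since [N.+1 <= 2 * N], the number of codes below is at most [N.-1 * N ^ n], less than the number
   [N ^ n.+1] of grid points. *)
pose N := (n.+1 * 2 * 2 ^ n * M.+1 ^ n.+1).+1.
have N0 : 0 < N%:R :> R by rewrite ltr0n.
pose w (k : {ffun 'I_n.+1 -> 'I_N}) : 'rV[R]_n.+1 := \row_i (delta * (k i)%:R / N%:R).
have wd k : `|w k| < delta.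
  apply: (@le_lt_trans _ _ (delta * (N.-1)%:R / N%:R)).
    apply: rV_norm_le => [|i]; first by rewrite divr_ge0 // mulr_ge0 // ltW.
    rewrite mxE ger0_norm; last by rewrite divr_ge0 // mulr_ge0 // ltW.
    by rewrite ler_wpM2r ?invr_ge0 // ler_wpM2l ?(ltW delta0) // ler_nat -ltnS.
  by rewrite ltr_pdivrMr // ltr_pM2l // ltr_nat.
pose y k := sval (cid (sol _ (wd k))).
have yp k : `|y k - p| = eps by have [] := svalP (cid (sol _ (wd k))).
have Ey k : E (y k) = w k by have [] := svalP (cid (sol _ (wd k))).
have face k : exists i, `|(y k - p) ord0 i| = eps.
  have : mx_norm (y k - p) != 0.
    by move: (yp k); rewrite /Num.Def.normr/= => ->; rewrite gt_eqF.
  move=> /mx_norm_neq0[[j i] /=]; rewrite ord1 => yi; exists i.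
  by rewrite -yi -(yp k).
pose I k := sval (cid (face k)).
have IP k : `|(y k - p) ord0 (I k)| = eps by exact: svalP (cid (face k)).
pose t k i := ((y k - p) ord0 i + eps) / (2 * eps) * N%:R.
have e2 : 0 < 2 * eps by rewrite mulr_gt0.
have coord_le k i : - eps <= (y k - p) ord0 i <= eps.
  by rewrite -ler_norml -(yp k); exact: rV_coord_le.
have t0 k i : 0 <= t k i.
  rewrite mulr_ge0 // divr_ge0 //; last exact: ltW.
  have /andP[] := coord_le k i; lra.
have tN k i : t k i <= N%:R.
  rewrite -[leRHS]mul1r ler_wpM2r // ler_pdivrMr // mul1r.
  have /andP[] := coord_le k i; lra.
have truncN k i : (Num.truncn (t k i) < N.+1)%N.
  by rewrite truncn_lt_nat // (le_lt_trans (tN k i)) // ltr_nat.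
(* Direction and sign of the face, cell in the face, residues of the index: the first three locate
   [y k] up to [2 * eps / N], and the residues then determine [k]. *)
pose T' := ('I_n.+1 * bool * {ffun 'I_n -> 'I_N.+1} * {ffun 'I_n.+1 -> 'I_M.+1})%type.
pose code k : T' := (I k, 0 <= (y k - p) ord0 (I k),
  [ffun j => inord (Num.truncn (t k (lift (I k) j)))],
  [ffun i => inord (k i %% M.+1)]).
have code_inj : injective code.
  move=> k k' [Ik sg /ffunP cell /ffunP md].
  have close : `|y k - y k'| <= 2 * eps / N%:R.
    apply: rV_norm_le => [|i]; first by rewrite divr_ge0 // ltW.
    have -> : (y k - y k') ord0 i = (y k - p) ord0 i - (y k' - p) ord0 i.
      by rewrite !mxE; ring.
    have [j ->|->] := unliftP (I k) i; last first.
      have := IP k; have := IP k'; rewrite -Ik in sg *.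
      case: (leP 0 ((y k - p) ord0 (I k))) sg => s; case: leP => // s' _.
        rewrite (ger0_norm s) (ger0_norm s') => -> ->.
        by rewrite subrr normr0 divr_ge0 // ltW.
      rewrite (ltr0_norm s) (ltr0_norm s') => e1 e3.
      have -> : (y k - p) ord0 (I k) - (y k' - p) ord0 (I k) = 0 by lra.
      by rewrite normr0 divr_ge0 // ltW.
    have := cell j; rewrite !ffunE => /(congr1 val) /=.
    rewrite !inordK // -Ik => tt.
    have := truncn_itv (t0 k (lift (I k) j)).
    have := truncn_itv (t0 k' (lift (I k) j)); rewrite tt.
    rewrite -natr1 => /andP[a1 a2] /andP[a3 a4].
    have : `|t k (lift (I k) j) - t k' (lift (I k) j)| <= 1 by rewrite ler_norml; lra.
    rewrite /t -mulrBl -mulrBl normrM normrM (gtr0_norm N0).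
    rewrite (gtr0_norm (x := (2 * eps)^-1)) ?invr_gt0 //.
    rewrite -ler_pdivlMr // mul1r ler_pdivrMr // mulrC.
    rewrite (_ : _ + eps - _ = (y k - p) ord0 (lift (I k) j) -
      (y k' - p) ord0 (lift (I k) j)) //; by ring.
  apply/ffunP => i; apply: val_inj => /=.
  have := md i; rewrite !ffunE => /(congr1 val) /=.
  rewrite !inordK ?ltn_mod // => kmod.
  have : `|w k - w k'| <= c * (2 * eps / N%:R).
    rewrite -!Ey (le_trans (Ec _ _)) // ler_wpM2l //.
  move=> /(le_trans (rV_coord_le _ i)); rewrite !mxE => wkk.
  apply: (eq_modn_close kmod); apply: le_lt_trans Mgt.
  have N0' : 0 < N%:R^-1 :> R by rewrite invr_gt0.
  rewrite ler_pdivlMr // -(ler_pM2r N0') (le_trans _ (le_trans wkk _)) //.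
    rewrite -mulrBl -mulrBr !normrM (gtr0_norm delta0).
    rewrite (gtr0_norm (x := N%:R^-1)) ?invr_gt0 //.
    by rewrite (mulrC delta).
  by rewrite !mulrA (mulrC c).
have := leq_card code code_inj.
rewrite !card_prod card_bool !card_ffun !card_ord.
apply/negP; rewrite -ltnNge.
have N1 : (N.+1 <= 2 * N)%N by rewrite mul2n -addnn -addn1 leq_add2l.
apply: (@leq_ltn_trans (n.+1 * 2 * (2 * N) ^ n * M.+1 ^ n.+1)).
  have expW e a b : (a <= b -> a ^ e <= b ^ e)%N by case: e => // e; rewrite leq_exp2r.
  by rewrite leq_mul2r leq_mul2l expW ?orbT.
rewrite expnMn (expnS N).
rewrite (_ : (_ * _ * _ * _ = (n.+1 * 2 * 2 ^ n * M.+1 ^ n.+1) * N ^ n)%N).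
  by rewrite ltn_pmul2r ?expn_gt0.
by rewrite !mulnA mulnAC.
Qed.
(* For [eta <= |y - p|], this map pushes [y] radially out of the ball of radius [eps]
   around [p]. *)
Lemma push_continuous n (p : 'rV[R]_n) (eps eta : R) : 0 < eta ->
  continuous (fun y : 'rV[R]_n => p + Num.max 1 (eps / Num.max `|y - p| eta) *: (y - p)).
Proof.
move=> eta0 y.
have yp : (fun z : 'rV[R]_n => z - p) @ y --> y - p.
    apply: (@lipschitz_continuous _ _ _ 1 (fun z => z - p)) => u v.
  by rewrite mul1r opprB addrA subrK.
have sy : Num.max 1 (eps / Num.max `|z - p| eta) @[z --> y] -->
    Num.max 1 (eps / Num.max `|y - p| eta).
  apply: (@continuous_max _ _ (fun=> 1)
    (fun y : 'rV[R]_n => eps / Num.max `|y - p| eta)).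
    exact: cst_continuous.
  have my : Num.max `|z - p| eta @[z --> y] --> Num.max `|y - p| eta.
    apply: (@continuous_max _ _ (fun y : 'rV[R]_n => `|y - p|) (fun=> eta)); last first.
      exact: cst_continuous.
    exact: cvg_norm yp.
  apply: (cvgM (cvg_cst eps) (cvgV _ my)).
  by rewrite gt_eqF // lt_max eta0 orbT.
exact: (cvgD (cvg_cst p) (cvgZ sy yp)).
Qed.

(* Invariance of domain by the argument of Kulpa and Tao: were [p] close to [G a]
   but not a value of [G], pushing the values of [G] out of a ball around [p] and
   translating by a generic small [w] would turn the inverse [E] of [G] into a map
   [E (Phi (G x)) - (a + w)] close to [x - a] without zero. *)
Lemma bilipschitz_open n (D : set 'rV[R]_n) (G : 'rV[R]_n -> 'rV[R]_n) c L a rho :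
  0 < c -> 0 < L -> 0 < rho ->
  (forall x x', `|G x - G x'| <= L * `|x - x'|) ->
  (forall x x', D x -> D x' -> `|x - x'| <= c * `|G x - G x'|) ->
  (forall x, `|x - a| <= rho -> D x) ->
  exists2 e, 0 < e & forall p, `|p - G a| < e -> exists2 x, D x & G x = p.
Proof.
move=> c0 L0 rho0 GL Gc aD.
have Gcont : continuous G by exact: lipschitz_continuous GL.
have Da : D a by apply: aD; rewrite subrr normr0 ltW.
have [E [Ec EG]] := lipschitz_left_inverse (ltW c0) (ex_intro D a Da) Gc.
have Econt : continuous E by exact: lipschitz_continuous Ec.
(* [Phi] moves values of [G] by at most [eps], hence [E] of them by [c * eps]; the translation adds
   less than [eps / (2 * L)]. The sum is exactly the displacement [rho] allowed by
   [near_id_zero]. *)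
pose eps := rho / (c + (2 * L)^-1).
have L20 : 0 < (2 * L)^-1 by rewrite invr_gt0 mulr_gt0.
have cL0 : 0 < c + (2 * L)^-1 by rewrite addr_gt0.
have eps0 : 0 < eps by rewrite divr_gt0.
have epsE : c * eps + eps / (2 * L) = rho.
  by rewrite (mulrC c) -mulrDr divfK // gt_eqF.
exists (eps / 2) => [|p pa]; first by rewrite divr_gt0.
apply: contrapT => np.
(* As [p] is not a value, compactness keeps the values of [G] away from it. The cut-off [eta] makes
   [Phi] continuous at [p] without affecting it at those values. *)
have [eta eta0 Geta] : exists2 eta, 0 < eta &
    forall x, `|x - a| <= rho -> eta <= `|G x - p|.
  have Gpcont : continuous (fun x => `|G x - p|).
    apply: (@lipschitz_continuous _ _ _ L) => x y.
    apply: le_trans (GL x y).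
    by rewrite (le_trans (ler_dist_dist _ _)) // opprB addrA subrK.
  have [|x /[!inE] /= xa xmin] := @compact_EVT_min _ R (fun x => `|G x - p|) _ _
      (@closed_ball_compact R n a rho) (continuous_subspaceT Gpcont).
    by exists a; rewrite /= subrr normr0 ltW.
  exists `|G x - p|.
    rewrite normr_gt0 subr_eq0; apply/eqP => Gx; apply: np.
    by exists x => //; apply: aD.
  by move=> y ya; apply: xmin; rewrite inE.
pose Phi y := p + Num.max 1 (eps / Num.max `|y - p| eta) *: (y - p).
have [w wlt wav] : exists2 w, `|w| < eps / (2 * L) &
    forall y, `|y - p| = eps -> E y - a <> w.
  apply: (sphere_image_avoid (c := c)) => //; first exact: ltW.
    by move=> y z; rewrite opprB addrA subrK.
  by rewrite divr_gt0 // mulr_gt0.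
have Phi_far y : eps <= `|y - p| -> Phi y = y.
  move=> ye; rewrite /Phi (max_idPl _) ?scale1r; first by rewrite addrC subrK.
  have yp0 : 0 < Num.max `|y - p| eta by rewrite lt_max eta0 orbT.
  by rewrite ler_pdivrMr // mul1r le_max ye.
have Phi_near y : eta <= `|y - p| -> `|y - p| < eps ->
    `|Phi y - p| = eps /\ `|Phi y - y| <= eps.
  move=> ey ye; have yp0 := lt_le_trans eta0 ey.
  have s1 : 1 <= eps / `|y - p| by rewrite ler_pdivlMr // mul1r ltW.
  rewrite /Phi (max_idPl ey) (max_idPr s1); split.
    by rewrite addrC addKr normrZ gtr0_norm ?divr_gt0 // divfK // gt_eqF.
  rewrite (_ : _ - y = (eps / `|y - p| - 1) *: (y - p)); last first.
    by rewrite scalerBl scale1r opprB addrA [p + _]addrC.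
  rewrite normrZ ger0_norm ?subr_ge0 // mulrBl divfK ?gt_eqF //; lra.
have Phi_move x : `|x - a| <= rho -> `|Phi (G x) - G x| <= eps.
  move=> /Geta ex; have [/Phi_far->|/(Phi_near _ ex)[]//] := leP eps `|G x - p|.
  by rewrite subrr normr0 ltW.
have [|x xa|x xa] := @near_id_zero R n a rho (fun x => E (Phi (G x)) - (a + w)) rho0.
- have EPcont : continuous (E \o (Phi \o G)).
    move=> x; apply: continuous_comp; last exact: Econt.
    by apply: continuous_comp; [exact: Gcont|exact: push_continuous].
  by move=> x; exact: (cvgB (EPcont x) (cvg_cst (a + w))).
- have -> : E (Phi (G x)) - (a + w) - (x - a) = E (Phi (G x)) - E (G x) - w.
    rewrite EG; last exact: aD.
    by apply/rowP => i; rewrite !mxE; ring.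
  have := ler_normB (E (Phi (G x)) - E (G x)) w.
  have := Ec (Phi (G x)) (G x); have := Phi_move x xa; rewrite -(ler_pM2l c0); lra.
move=> /eqP; rewrite subr_eq0 => /eqP Ex.
(* A value near [p] is pushed onto the sphere, whose image under [E] avoids [a + w]. A far value is
   fixed, so [x = a + w]; then [G x] is within [L * |w| < eps / 2] of [G a], hence within [eps] of
   [p]. *)
have [far|near] := leP eps `|G x - p|; last first.
  have [Pe _] := Phi_near _ (Geta x xa) near.
  by apply: (wav _ Pe); rewrite Ex addrC addKr.
move: Ex; rewrite Phi_far // EG; last exact: aD.
move=> xaw; have wE : w = x - a by rewrite xaw addrC addKr.
have : `|G x - G a| <= L * `|w| by rewrite wE.
have : L * `|w| < eps / 2.
  by rewrite mulrC -ltr_pdivlMr // -mulrA -invfM.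
have := ler_distD (G a) (G x) p; rewrite (distrC (G a)); lra.
Qed.

(** Continuity method along the segment from 0 to [y]: the set of [t] for which [t *: y] is attained
    contains its supremum, by continuity of [G] and [E], and can be continued beyond any [s < 1] by
    [bilipschitz_open]. The bound on [y] keeps the path [E (t *: y)] inside the ball. *)
Lemma bilipschitz_surj n (G : 'rV[R]_n -> 'rV[R]_n) c L a rho y :
  0 < c -> 0 < L ->
  (forall x x', `|G x - G x'| <= L * `|x - x'|) ->
  (forall x x', `|x - a| < rho -> `|x' - a| < rho ->
    `|x - x'| <= c * `|G x - G x'|) ->
  G a = 0 -> c * `|y| < rho -> exists2 x, `|x - a| < rho & G x = y.
Proof.
move=> c0 L0 GL Gc Ga yrho.
pose D := [set x : 'rV[R]_n | `|x - a| < rho].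
have Da : D a.
  by rewrite /D /= subrr normr0; apply: le_lt_trans yrho; rewrite mulr_ge0 // ltW.
have [E [Ec EG]] := lipschitz_left_inverse (ltW c0) (ex_intro D a Da) Gc.
have E0 : E 0 = a by rewrite -Ga EG.
pose S := [set t : R | 0 <= t <= 1 /\ exists2 x, D x & G x = t *: y].
have S0 : S 0 by split; [rewrite lexx ler01|exists a; rewrite ?scale0r].
have Ssup : has_sup S by split; [exists 0|exists 1 => t [/andP[]]].
pose s := sup S.
have sle t : S t -> t <= s by move=> St; apply: ub_le_sup => //; case: Ssup.
have s0 : 0 <= s by exact: sle.
have s1 : s <= 1 by apply: ge_sup; [exists 0|move=> t [/andP[]]].
have ED t : 0 <= t -> t <= 1 -> D (E (t *: y)).
  move=> t0 t1; rewrite /D /= -E0; apply: le_lt_trans (Ec _ _) _.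
  rewrite subr0 normrZ ger0_norm //; apply: le_lt_trans yrho.
  by rewrite ler_pM2l // ler_piMl.
have GEs : G (E (s *: y)) = s *: y.
  apply/eqP; rewrite -subr_eq0 -normr_le0 leNgt; apply/negP => d0.
  set d := `|_| in d0.
  (* The defect [d] at [s] is at most [(L * c + 1) * (s - t) * |y|] for any [t] in [S], so a [t]
     closer to [s] than [d / M] is contradictory; the summand 1 next to [|y|] covers [y = 0]. *)
  pose M := (L * c + 1) * (`|y| + 1).
  have Lc0 : 0 < L * c + 1 by rewrite ltr_pwDr // mulr_ge0 // ltW.
  have M0 : 0 < M by rewrite mulr_gt0 // ltr_wpDl.
  have [t St ts] := sup_adherent (divr_gt0 d0 M0) Ssup.
  have tles := sle t St.
  have GEt : G (E (t *: y)) = t *: y by case: St => _ [x Dx Gx]; rewrite -Gx EG.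
  have : d <= (L * c + 1) * ((s - t) * `|y|).
    have -> : (s - t) * `|y| = `|s *: y - t *: y|.
      by rewrite -scalerBl normrZ ger0_norm // subr_ge0.
    have := ler_distD (t *: y) (G (E (s *: y))) (s *: y).
    rewrite -[X in `|_ - X| + _]GEt (distrC (t *: y)).
    have := le_trans (GL (E (s *: y)) (E (t *: y))) (ler_wpM2l (ltW L0) (Ec (s *: y) (t *: y))).
    rewrite mulrDl mul1r mulrA /d; lra.
  apply/negP; rewrite -ltNge.
  have : (s - t) * M < d by rewrite -ltr_pdivlMr // ltrBlDr addrC -ltrBlDr.
  apply: le_lt_trans; rewrite /M [leRHS]mulrCA (ler_pM2l Lc0).
  by rewrite ler_wpM2l ?subr_ge0 // lerDl.
have [s1'|s1'] := ltP s 1; last first.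
  have sE : s = 1 by apply/le_anti; rewrite s1.
  exists (E (s *: y)); first exact: ED.
  by rewrite GEs sE scale1r.
exfalso.
pose eta := (rho - `|E (s *: y) - a|) / 2.
have eta0 : 0 < eta by rewrite divr_gt0 // subr_gt0; exact: ED.
have [x xE|e e0 eG] := @bilipschitz_open n D G c L (E (s *: y)) eta c0 L0 eta0 GL Gc.
  rewrite /D /=; have := ler_distD (E (s *: y)) x a; move: xE eta0; rewrite /eta; lra.
rewrite GEs in eG.
pose h := Num.min (1 - s) (e / (2 * (`|y| + 1))).
have y1 : 0 < `|y| + 1 by rewrite ltr_wpDl.
have h0 : 0 < h by rewrite lt_min subr_gt0 s1' divr_gt0 // mulr_gt0.
have h1 : h <= 1 - s by rewrite ge_min lexx.
have hy : h * `|y| < e.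
  apply: (@le_lt_trans _ _ (h * (`|y| + 1))); first by rewrite ler_pM2l // lerDl.
  rewrite -ltr_pdivlMr // gt_min; apply/orP; right.
  by rewrite invfM mulrA ltr_pM2r ?invr_gt0 // gtr_pMr // invf_lt1 // ltr1n.
have /sle : S (s + h).
  split; first by apply/andP; split; lra.
  by apply: eG; rewrite -scalerBl addrC addKr normrZ gtr0_norm.
lra.
Qed.

End Invariance.

(** * Secant slopes of an elemental *)

Section SecantSlope.
Context {R : realType}.
Implicit Types (phi : R -> R) (c h t : R).

Definition secant_slope phi c h : R :=
  if c != h then (phi c - phi h) / (c - h) else derive1 phi ((c + h) / 2).

Definition secant_line phi c h t : R :=
  (phi c + phi h) / 2 + secant_slope phi c h * (t - (c + h) / 2).

Lemma secant_slopeC phi c h : secant_slope phi c h = secant_slope phi h c.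
Proof.
rewrite /secant_slope [h == c]eq_sym; case: eqVneq => [->//|_] /=.
by rewrite -(opprB (phi h)) -(opprB h) invrN mulrNN.
Qed.

Lemma secant_slopeM phi c h : secant_slope phi c h * (c - h) = phi c - phi h.
Proof.
rewrite /secant_slope; have [->|ch] /= := eqVneq c h; first by rewrite !subrr mulr0.
by rewrite divfK // subr_eq0.
Qed.

Lemma secant_lineEr phi c h t :
  secant_line phi c h t = phi h + secant_slope phi c h * (t - h).
Proof. have := secant_slopeM phi c h; rewrite /secant_line; set s := secant_slope _ _ _; nra. Qed.

Lemma secant_lineEl phi c h t :
  secant_line phi c h t = phi c + secant_slope phi c h * (t - c).
Proof. have := secant_slopeM phi c h; rewrite /secant_line; set s := secant_slope _ _ _; nra. Qed.

Section Bounds.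
Variables (J : set R) (phi : R -> R) (L L' : R).
Hypothesis J_itv : is_interval J.
Hypothesis phi_drv : forall t, J t -> derivable phi t 1.
Hypothesis phi_L : forall t, J t -> `|derive1 phi t| <= L.
Hypothesis phi_L' : forall s t, J s -> J t ->
  `|derive1 phi s - derive1 phi t| <= L' * `|s - t|.
Hypothesis L'0 : 0 <= L'.

Let phi_is t : J t -> is_derive t 1 phi (derive1 phi t).
Proof. by move=> Jt; rewrite derive1E; apply/derivableP/phi_drv. Qed.

Let mvt a b : a < b -> J a -> J b ->
  exists xi, [/\ J xi, a <= xi <= b & phi b - phi a = derive1 phi xi * (b - a)].
Proof.
move=> ab Ja Jb; have Jab t : a <= t <= b -> J t by exact: J_itv.
have drv t : t \in `]a, b[ -> is_derive t 1 phi (derive1 phi t).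
  by rewrite in_itv /= => /andP[/ltW at_ /ltW tb]; apply/phi_is/Jab; rewrite at_.
have cont : {within `[a, b], continuous phi}.
  apply: derivable_within_continuous => t; rewrite in_itv /= => /Jab.
  exact: phi_drv.
have [xi] := MVT ab drv cont.
rewrite in_itv /= => /andP[/ltW axi /ltW xib] E.
by exists xi; split; rewrite ?axi //; apply: Jab; rewrite axi.
Qed.

(** The bound on [xi] forces [xi = h] when [c = h]; [secant_slope_lip] relies on it when a pair of
    reference points coincides. *)
Lemma secant_slope_mean c h : J c -> J h ->
  exists xi, [/\ J xi, `|xi - h| <= `|c - h| & secant_slope phi c h = derive1 phi xi].
Proof.
move=> Jc Jh; have [ch|hc|<-] := ltgtP c h.
- have [xi [Jxi /andP[cxi xih] E]] := mvt ch Jc Jh; exists xi; split=> //.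
    rewrite !ler0_norm; lra.
  by rewrite secant_slopeC /secant_slope gt_eqF //= E mulfK // subr_eq0 gt_eqF.
- have [xi [Jxi /andP[hxi xic] E]] := mvt hc Jh Jc; exists xi; split=> //.
    rewrite !ger0_norm; lra.
  by rewrite /secant_slope gt_eqF //= E mulfK // subr_eq0 gt_eqF.
by exists c; split; rewrite // /secant_slope eqxx /=; congr (derive1 phi _); lra.
Qed.

Lemma secant_slope_le c h : J c -> J h -> `|secant_slope phi c h| <= L.
Proof. by move=> Jc Jh; have [xi [Jxi _ ->]] := secant_slope_mean Jc Jh; exact: phi_L. Qed.

Lemma secant_dist_le c h : J c -> J h -> `|phi c - phi h| <= L * `|c - h|.
Proof.
by move=> Jc Jh; rewrite -secant_slopeM normrM ler_wpM2r // secant_slope_le.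
Qed.

(* For [c <> h] and [c' <> h] the two slopes are the increments over [0, 1] of
   antiderivatives of [s |-> phi' (h + s (c - h))] and [s |-> phi' (h + s (c' - h))],
   so that the mean value theorem applies to the difference. *)
Lemma secant_slope_lip c c' h : J c -> J c' -> J h ->
  `|secant_slope phi c h - secant_slope phi c' h| <= L' * `|c - c'|.
Proof.
move=> Jc Jc' Jh.
have diag d : J d ->
    `|secant_slope phi d h - secant_slope phi h h| <= L' * `|d - h|.
  move=> Jd; have [xi [Jxi xid ->]] := secant_slope_mean Jd Jh.
  have [xi' [_ + ->]] := secant_slope_mean Jh Jh.
  rewrite subrr normr0 normr_le0 subr_eq0 => /eqP ->.
  by apply: le_trans (phi_L' Jxi Jh) _; rewrite ler_wpM2l.
have [->|ch] := eqVneq c h; first by rewrite distrC (distrC h); exact: diag.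
have [->|c'h] := eqVneq c' h; first exact: diag.
pose p d (s : R) := (d - h)^-1 * phi (h + (d - h) * s).
have Jseg d (s : R) : J d -> 0 <= s <= 1 -> J (h + (d - h) * s).
  move=> Jd /andP[s0 s1]; have [hd|dh] := leP h d.
    by apply: (J_itv Jh Jd); apply/andP; split; nra.
  by apply: (J_itv Jd Jh); apply/andP; split; nra.
have p_is d (s : R) : J d -> d != h -> 0 <= s <= 1 ->
    is_derive s 1 (p d) (derive1 phi (h + (d - h) * s)).
  move=> Jd dh s01; have dh0 : d - h != 0 by rewrite subr_eq0.
  have lin : is_derive s 1 (cst h + (d - h) \*: (@id R)) (0 + (d - h) *: 1).
    exact: (is_deriveD (is_derive_cst h s 1) (is_deriveZ (d - h) (is_derive_id s 1))).
  have comp := is_deriveZ (d - h)^-1 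
    (@is_derive1_comp R phi (cst h + (d - h) \*: (@id R)) s _ _
      (phi_is (Jseg _ _ Jd s01)) lin).
  apply: (is_derive_eq comp).
  by rewrite add0r /GRing.scale /= mulr1 mulrC mulfK.
have cc'_is (s : R) : 0 <= s <= 1 -> is_derive s 1 (p c - p c')
    (derive1 phi (h + (c - h) * s) - derive1 phi (h + (c' - h) * s)).
  by move=> s01; exact: (is_deriveB (p_is _ _ Jc ch s01) (p_is _ _ Jc' c'h s01)).
have drv (s : R) : s \in `]0, 1[ -> is_derive s 1 (p c - p c')
    (derive1 phi (h + (c - h) * s) - derive1 phi (h + (c' - h) * s)).
  by rewrite in_itv /= => /andP[/ltW s0 /ltW s1]; apply: cc'_is; rewrite s0.
have cont : {within `[0, 1], continuous (p c - p c')}.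
  apply: derivable_within_continuous => s; rewrite in_itv /= => /cc'_is[].
  by [].
have [s] := MVT ltr01 drv cont.
rewrite in_itv /= => /andP[/ltW s0 /ltW s1].
have s01 : 0 <= s <= 1 by rewrite s0.
have p1 d : J d -> d != h -> p d 1 - p d 0 = secant_slope phi d h.
  move=> Jd dh; rewrite /p /secant_slope dh /= mulr1 mulr0 addr0 (addrC h) subrK.
  by rewrite -mulrBr mulrC.
rewrite subr0 mulr1 => E.
rewrite -(p1 _ Jc ch) -(p1 _ Jc' c'h).
have -> : p c 1 - p c 0 - (p c' 1 - p c' 0) = (p c 1 - p c' 1) - (p c 0 - p c' 0).
  by ring.
rewrite [X in `|X|]E; apply: (le_trans (phi_L' (Jseg _ _ Jc s01) (Jseg _ _ Jc' s01))).
rewrite ler_wpM2l // (_ : _ - _ = (c - c') * s); last by ring.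
by rewrite normrM ler_piMr // ger0_norm.
Qed.

End Bounds.
End SecantSlope.

(** * Estimates for the piecewise linear models *)

Section Trace.
Context {R : realType} {T : Type}.
Implicit Types (step : seq T -> instr R -> T) (s : seq T) (P : seq (instr R)).

Lemma size_trace step s P : size (trace step s P) = (size s + size P)%N.
Proof.
elim: P s => [|ins P IH] s; first by rewrite addn0.
by rewrite /= /trace /= -/(trace _ _ _) IH size_rcons addSnnS.
Qed.

Lemma take_trace step s P : take (size s) (trace step s P) = s.
Proof.
elim: P s => [|ins P IH] s; first by rewrite take_size.
rewrite /trace /= -/(trace _ _ _).
have /(congr1 (take (size s))) := IH (rcons s (step s ins)).
by rewrite take_takel ?size_rcons // => ->; rewrite -cats1 take_size_cat.
Qed.

Lemma nth_trace_init x0 step s P j : (j < size s)%N ->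
  nth x0 (trace step s P) j = nth x0 s j.
Proof. by move=> js; rewrite -[in RHS](take_trace step s P) nth_take. Qed.

(** The prefix has to stay visible, because [increment_step] reads its position off the length of
    the list. *)
Lemma nth_trace_step x0 ins0 step s P k : (k < size P)%N ->
  nth x0 (trace step s P) (size s + k) =
  step (take (size s + k) (trace step s P)) (nth ins0 P k).
Proof.
move=> kP; set t := trace step s (take k P).
have st : size t = (size s + k)%N by rewrite size_trace size_takel // ltnW.
have E : trace step s P =
    trace step (rcons t (step t (nth ins0 P k))) (drop k.+1 P).
  rewrite -[in LHS](cat_take_drop k P) (drop_nth ins0 kP).
  by rewrite /trace foldl_cat.
have tE : take (size s + k) (trace step s P) = t.
  have := take_trace step (rcons t (step t (nth ins0 P k))) (drop k.+1 P).
  move=> /(congr1 (take (size t))); rewrite take_takel ?size_rcons // -E st => ->.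
  by rewrite -cats1 -st take_size_cat.
by rewrite tE E nth_trace_init ?size_rcons ?st // nth_rcons st ltnn eqxx.
Qed.

End Trace.

Lemma program_ind (n l : nat) (Q : nat -> Prop) :
  (forall i : 'I_n, Q i) ->
  (forall k, (k < l)%N -> (forall j, (j < n + k)%N -> Q j) -> Q (n + k)%N) ->
  forall j, (j < n + l)%N -> Q j.
Proof.
move=> Qin Qstep j; elim/ltn_ind: j => j IH jl.
have [jn|nj] := ltnP j n; first exact: (Qin (Ordinal jn)).
rewrite -(subnKC nj); apply: Qstep => [|i]; first by rewrite ltn_subLR.
by rewrite subnKC // => ij; apply: IH => //; exact: ltn_trans jl.
Qed.

Section Model.
Context {R : realType} {n : nat} {P : seq (instr R)} {Omega : set 'rV[R]_n}.
Hypothesis wf : well_formed P Omega.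
Implicit Types (x xc xh : 'rV[R]_n).

Let V x j := (values P x)`_j.

(* The value at position [j] of the piecewise linear model, so that the linear
   increments of the definition become secant lines of the elementals. *)
Definition model_value xc xh x j : R :=
  (V xc j + V xh j) / 2 + (increments P xc xh (x - 2^-1 *: (xc + xh)))`_j.

Lemma size_inputs x : size (inputs x) = n.
Proof. by rewrite size_map size_enum_ord. Qed.

Lemma nth_inputs x (i : 'I_n) : (inputs x)`_i = x ord0 i.
Proof.
by rewrite (nth_map i) ?size_enum_ord // nth_ord_enum.
Qed.

Lemma value_input x (i : 'I_n) : V x i = x ord0 i.
Proof. by rewrite /V nth_trace_init ?size_inputs // nth_inputs. Qed.

Lemma value_instr x k : (k < size P)%N ->
  V x (n + k) = match nth (VAbs R 0) P k with
  | VAdd i j => V x i + V x j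
  | VAbs j => `|V x j|
  | VElem _ phi j => phi (V x j)
  end.
Proof.
move=> kP; have := wf kP; rewrite /V /values.
have := nth_trace_step 0 (VAbs R 0) value_step (inputs x) kP.
rewrite size_inputs => ->; case: (nth _ P k) => [i j [ik jk]|j jk|D phi j [jk _ _]] /=;
  by rewrite !nth_take.
Qed.

Lemma model_input xc xh x (i : 'I_n) : model_value xc xh x i = x ord0 i.
Proof.
rewrite /model_value !value_input /increments nth_trace_init ?size_inputs //.
by rewrite nth_inputs !mxE; lra.
Qed.

Lemma model_instr xc xh x k : (k < size P)%N ->
  let M := model_value xc xh x in
  M (n + k)%N = match nth (VAbs R 0) P k with
  | VAdd i j => M i + M j
  | VAbs j => `|M j|
  | VElem _ phi j => secant_line phi (V xc j) (V xh j) (M j)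
  end.
Proof.
move=> kP M; have := wf kP; have := value_instr xc kP; have := value_instr xh kP.
rewrite /M /model_value /increments; set dx := x - _.
set step := increment_step _ _.
have := nth_trace_step 0 (VAbs R 0) step (inputs dx) kP; rewrite size_inputs => ->.
have size_t : size (take (n + k) (trace step (inputs dx) P)) = (n + k)%N.
  by rewrite size_takel // size_trace size_inputs leq_add2l ltnW.
rewrite /step in size_t *; case: (nth _ P k) => [i j|j|D phi j] /= Vh Vc; rewrite ?size_t -!/(V _ _) Vh Vc.
- by move=> [ik jk]; rewrite !nth_take //; lra.
- by move=> jk; rewrite nth_take // [LHS]addrC subrK.
- by move=> [jk _ _]; rewrite nth_take // /secant_line [in RHS]addrAC subrr add0r.
Qed.

Lemma secant_model_entry xc xh x (i : 'I_n) :
  secant_model P xc xh x ord0 i = model_value xc xh x (size P + i).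
Proof. by rewrite !mxE mulrC. Qed.

Section Estimates.
Variable K : set 'rV[R]_n.
Hypothesis K_convex : convex_set (K : set (convex_lmodType 'rV[R]_n)).
Hypothesis K_Omega : K `<=` Omega.
Hypothesis K_finite : finite_constants P K.
Hypothesis K_neq0 : K !=set0.

Let beta j := (nth (0, 0) (bounds P K) j).1.
Let gamma j := (nth (0, 0) (bounds P K) j).2.
Let M := model_value.

Lemma bounds_input (i : 'I_n) : beta i = 1 /\ gamma i = 0.
Proof.
by rewrite /beta /gamma /bounds nth_trace_init ?size_nseq // nth_nseq ltn_ord.
Qed.

Lemma bounds_instr k : (k < size P)%N ->
  match nth (VAbs R 0) P k with
  | VAdd i j => beta (n + k)%N = beta i + beta j /\ gamma (n + k)%N = gamma i + gamma j
  | VAbs j => beta (n + k)%N = beta j /\ gamma (n + k)%N = gamma j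
  | VElem _ phi j =>
      let L := sup (slopes phi (V^~ j) K) in
      let L' := inf (lip_bounds phi (V^~ j) K) in
      beta (n + k)%N = beta j * L /\
      gamma (n + k)%N = L * gamma j + L' * beta j ^+ 2
  end.
Proof.
move=> kP; have := wf kP; rewrite /beta /gamma /bounds.
have := nth_trace_step (0, 0) (VAbs R 0) (bound_step P K) (nseq n (1, 0)) kP.
rewrite size_nseq => ->; case: (nth _ P k) => [i j [ik jk]|j jk|D phi j [jk _ _]] /=;
  by rewrite !nth_take.
Qed.

(** Supplies the interval on which the mean value theorem is applied to an elemental; this is where
    convexity of [K] enters. *)
Lemma lipschitz_image_interval (f : 'rV[R]_n -> R) C :
  (forall x y, K x -> K y -> `|f x - f y| <= C * `|x - y|) -> is_interval (f @` K).
Proof.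
move=> fC _ _ [x Kx <-] [y Ky <-] z /andP[xz zy].
(* Clamping keeps the path in [K] for every real parameter, so [f \o path] is continuous on the
   whole line although [f] is controlled on [K] only. *)
pose clamp (s : R) := Num.max 0 (Num.min 1 s).
have clamp0 s : 0 <= clamp s by rewrite le_max lexx.
have clamp1 s : clamp s <= 1 by rewrite ge_max ler01 ge_min lexx.
have clamp_lip s t : `|clamp s - clamp t| <= `|s - t|.
  have := ler_norm (s - t); have := ler_norm (t - s); rewrite (distrC t) => st ts.
  rewrite ler_norml /clamp /Order.max /Order.min; move: st ts.
  set e := `|_|; case: (ltP 1 s) => s1; case: (ltP 1 t) => t1;
    rewrite ?ltr01; case: (ltP 0 s) => s0; case: (ltP 0 t) => t0; lra.
pose path s := clamp s *: y + (1 - clamp s) *: x.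
have Kpath s : K (path s).
  by have := K_convex (Itv01 (clamp0 s) (clamp1 s)) (mem_set Ky) (mem_set Kx); rewrite inE.
have cont : continuous (f \o path).
  apply: (@lipschitz_continuous _ _ _ (`|C| * `|y - x|)) => s t /=.
  apply: le_trans (fC _ _ (Kpath s) (Kpath t)) _.
  have -> : path s - path t = (clamp s - clamp t) *: (y - x).
    by apply/rowP => i; rewrite !mxE; ring.
  rewrite normrZ (mulrC `|_ - _|) mulrA.
  apply: (@le_trans _ _ (`|C| * `|y - x| * `|clamp s - clamp t|)).
    by rewrite ler_wpM2r // ler_wpM2r // ler_norm.
  by rewrite ler_wpM2l // mulr_ge0.
have path0 : path 0 = x.
  by rewrite /path /clamp (min_idPr ler01) maxxx scale0r add0r subr0 scale1r.
have path1 : path 1 = y.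
  by rewrite /path /clamp minxx (max_idPr ler01) scale1r subrr scale0r addr0.
have [|s _ <-] := @IVT R (f \o path) 0 1 z ler01 (continuous_subspaceT cont).
  by rewrite /= path0 path1 (min_idPl (le_trans xz zy)) (max_idPr (le_trans xz zy)) xz.
by exists (path s).
Qed.

(** The estimates need each other, hence one induction: the Lipschitz bound on the values makes the
    arguments of an elemental fill an interval, and interpolation at [c] and [h] turns the Lipschitz
    bound on a model into a bound on its distance from the reference values. *)
Lemma program_estimates j : (j < n + size P)%N ->
  [/\ 0 <= beta j, 0 <= gamma j,
      forall x y, K x -> K y -> `|V x j - V y j| <= beta j * `|x - y|,
      forall c h, K c -> K h ->
        [/\ forall x y, `|M c h x j - M c h y j| <= beta j * `|x - y|,
            M c h c j = V c j & M c h h j = V h j] &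
      forall c h c' h', K c -> K h -> K c' -> K h' ->
        forall x, `|M c h x j - M c' h' x j| <=
          gamma j * (`|c - c'| * `|x - h| + `|h - h'| * `|x - c'|)].
Proof.
move: j; apply: program_ind => [i|k kP IH].
  have [-> ->] := bounds_input i; split=> // [x y _ _|c h _ _|c h c' h' _ _ _ _ x].
  - by rewrite !value_input mul1r; have := rV_coord_le (x - y) i; rewrite !mxE.
  - split=> [x y||]; rewrite /M !model_input ?value_input // mul1r.
    by have := rV_coord_le (x - y) i; rewrite !mxE.
  - by rewrite /M !model_input subrr normr0 mul0r.
have := wf kP; have := K_finite kP; have := bounds_instr kP.
have := fun x => value_instr x kP; have := fun c h x => model_instr c h x kP.
case: (nth _ P k) => [i j|j|D phi j] /= ME VE [bE gE] fin => [[ik jk]|jk|[jk C11 VD]].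
- have [bi gi Vi Mi Di] := IH i ik; have [bj gj Vj Mj Dj] := IH j jk.
  rewrite bE gE; split; rewrite ?addr_ge0 //.
  + move=> x y Kx Ky; rewrite !VE opprD addrACA mulrDl.
    by apply: le_trans (ler_normD _ _) _; rewrite lerD ?Vi ?Vj.
  + move=> c h Kc Kh; have [Mi1 Mi2 Mi3] := Mi c h Kc Kh; have [Mj1 Mj2 Mj3] := Mj c h Kc Kh.
    split=> [x y||]; rewrite /M !ME ?VE -/M ?Mi2 ?Mj2 ?Mi3 ?Mj3 //.
    rewrite opprD addrACA mulrDl.
    by apply: le_trans (ler_normD _ _) _; rewrite lerD.
  + move=> c h c' h' Kc Kh Kc' Kh' x; rewrite /M !ME -/M opprD addrACA mulrDl.
    by apply: le_trans (ler_normD _ _) _; rewrite lerD ?Di ?Dj.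
- have [bj gj Vj Mj Dj] := IH j jk.
  rewrite bE gE; split=> //.
  + by move=> x y Kx Ky; rewrite !VE; apply: le_trans (ler_dist_dist _ _) (Vj _ _ Kx Ky).
  + move=> c h Kc Kh; have [Mj1 Mj2 Mj3] := Mj c h Kc Kh.
    split=> [x y||]; rewrite /M !ME ?VE -/M ?Mj2 ?Mj3 //.
    exact: le_trans (ler_dist_dist _ _) (Mj1 _ _).
  + move=> c h c' h' Kc Kh Kc' Kh' x; rewrite /M !ME -/M.
    exact: le_trans (ler_dist_dist _ _) (Dj _ _ _ _ Kc Kh Kc' Kh' _).
have [bj gj Vj Mj Dj] := IH j jk.
have [ubL lbL'] := fin.
set L := sup _ in bE gE; set L' := inf _ in gE.
pose J := (V^~ j) @` K.
have J_itv : is_interval J := lipschitz_image_interval Vj.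
have [openD drvD _] := C11.
have drv t : J t -> derivable phi t 1.
  by move=> [x Kx <-]; apply: drvD; apply: VD; exact: K_Omega.
have phi_L t : J t -> `|derive1 phi t| <= L.
  by move=> [x Kx <-]; apply: ub_le_sup => //; exists x.
have phi_L' s t : J s -> J t -> `|derive1 phi s - derive1 phi t| <= L' * `|s - t|.
  move=> Js Jt; have [->|st] := eqVneq s t; first by rewrite !subrr !normr0 mulr0.
  have st0 : 0 < `|s - t| by rewrite normr_gt0 subr_eq0.
  rewrite -ler_pdivrMr //; apply: lb_le_inf => // b [_ lip].
  by rewrite ler_pdivrMr //; have := lip (s, t); apply.
have L'0 : 0 <= L' by apply: lb_le_inf => // b [].
have L0 : 0 <= L.
  by have [x Kx] := K_neq0; apply: le_trans (phi_L (V x j) _); last by exists x.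
have JV x : K x -> J (V x j) by exists x.
rewrite bE gE; split.
- by rewrite mulr_ge0.
- by rewrite addr_ge0 // mulr_ge0 // sqr_ge0.
- move=> x y Kx Ky; rewrite !VE (mulrC (beta j)) -mulrA.
  apply: le_trans (secant_dist_le J_itv drv phi_L (JV _ Kx) (JV _ Ky)) _.
  by rewrite ler_wpM2l // Vj.
- move=> c h Kc Kh; have [Mj1 Mj2 Mj3] := Mj c h Kc Kh.
  split=> [x y||]; rewrite /M !ME -/M; last 2 first.
  + by rewrite secant_lineEl Mj2 subrr mulr0 addr0 VE.
  + by rewrite secant_lineEr Mj3 subrr mulr0 addr0 VE.
  rewrite !secant_lineEr (_ : _ - _ = secant_slope phi (V c j) (V h j) * (M c h x j - M c h y j)).
    rewrite normrM (mulrC (beta j)) -mulrA ler_pM //.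
    exact: (secant_slope_le J_itv drv phi_L (JV _ Kc) (JV _ Kh)).
  by ring.
move=> c h c' h' Kc Kh Kc' Kh' x; rewrite /M !ME -/M.
set m := M c h x j; set m' := M c' h' x j.
have [Mj1 Mj2 Mj3] := Mj c h Kc Kh; have [Mj1' Mj2' Mj3'] := Mj c' h' Kc' Kh'.
(* The passage goes through the secant line for [(c', h)]: it meets the first line at [V h j] and
   the last at [V c' j], so each change of slope is multiplied by a distance from the shared point.
   This produces the mixed factors [|x - h|] and [|x - c'|]. *)
have -> : secant_line phi (V c j) (V h j) m - secant_line phi (V c' j) (V h' j) m' =
    secant_slope phi (V c' j) (V h j) * (m - m') +
    ((secant_slope phi (V c j) (V h j) - secant_slope phi (V c' j) (V h j)) * (m - V h j) +
     (secant_slope phi (V h j) (V c' j) - secant_slope phi (V h' j) (V c' j)) * (m' - V c' j)).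
  rewrite (secant_slopeC _ (V h j)) (secant_slopeC _ (V h' j)).
  rewrite secant_lineEr (secant_lineEl _ (V c' j)).
  have := secant_slopeM phi (V c' j) (V h j).
  set a := secant_slope _ _ _; set b := secant_slope _ _ _; set d := secant_slope _ _ _.
  by nra.
have := secant_slope_lip J_itv drv phi_L' L'0 (JV _ Kc) (JV _ Kc') (JV _ Kh).
have := secant_slope_lip J_itv drv phi_L' L'0 (JV _ Kh) (JV _ Kh') (JV _ Kc').
have := secant_slope_le J_itv drv phi_L (JV _ Kc') (JV _ Kh).
set a := _ - secant_slope _ _ _; set b := _ - secant_slope _ _ _; set d := secant_slope _ _ _.
move=> dL bL' aL'.
have mh : `|m - V h j| <= beta j * `|x - h| by rewrite -Mj3; exact: Mj1.
have mc : `|m' - V c' j| <= beta j * `|x - c'| by rewrite -Mj2'; exact: Mj1'.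
have mm := Dj _ _ _ _ Kc Kh Kc' Kh' x; rewrite -/m -/m' in mm.
have cc : `|V c j - V c' j| <= beta j * `|c - c'| by exact: Vj.
have hh : `|V h j - V h' j| <= beta j * `|h - h'| by exact: Vj.
rewrite [leRHS]mulrDl.
apply: le_trans (ler_normD _ _) _; apply: lerD.
  by rewrite normrM -mulrA ler_pM.
apply: le_trans (ler_normD _ _) _; rewrite [leRHS]mulrDr; apply: lerD; rewrite normrM.
  apply: (@le_trans _ _ (L' * (beta j * `|c - c'|) * (beta j * `|x - h|))).
    by rewrite ler_pM // (le_trans aL') // ler_wpM2l.
  by rewrite le_eqVlt; apply/orP; left; apply/eqP; ring.
apply: (@le_trans _ _ (L' * (beta j * `|h - h'|) * (beta j * `|x - c'|))).
  by rewrite ler_pM // (le_trans bL') // ler_wpM2l.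
by rewrite le_eqVlt; apply/orP; left; apply/eqP; ring.
Qed.

Lemma rV_subE (u v : 'rV[R]_n) i : (u - v) ord0 i = u ord0 i - v ord0 i.
Proof. by rewrite !mxE. Qed.

Lemma gammaF_ge0 : 0 <= gammaF P K.
Proof. by rewrite /gammaF; apply: bigmax_ge_id. Qed.

(** The default value 1 of the maximum makes the constant positive, also for [n = 0]; being
    independent of [c] and [h], it serves for the model at the root and for nearby ones alike. *)
Lemma secant_model_lipschitz c h : K c -> K h ->
  forall x y, `|secant_model P c h x - secant_model P c h y| <=
    (\big[Num.max/1]_(i < n) beta (size P + i)) * `|x - y|.
Proof.
move=> Kc Kh x y; set B := \big[_/_]_(_ < _) _.
have B0 : 0 <= B by apply: le_trans (bigmax_ge_id _ _ _ _); exact: ler01.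
apply: rV_norm_le => [|i]; first by rewrite mulr_ge0.
have /program_estimates[_ _ _ /(_ _ _ Kc Kh)[Mlip _ _] _] : (size P + i < n + size P)%N.
  by rewrite addnC ltn_add2r.
rewrite rV_subE !secant_model_entry; apply: le_trans (Mlip x y) _.
by rewrite ler_wpM2r // /B (le_bigmax _ (fun i : 'I_n => beta (size P + i))).
Qed.

Lemma secant_model_interpolates c h : K c -> K h -> secant_model P c h h = eval_prog P h.
Proof.
move=> Kc Kh; apply/rowP => i; rewrite secant_model_entry mxE.
have /program_estimates[_ _ _ /(_ _ _ Kc Kh)[_ _ E] _] : (size P + i < n + size P)%N.
  by rewrite addnC ltn_add2r.
exact: E.
Qed.

Lemma secant_model_dist c h c' h' : K c -> K h -> K c' -> K h' ->
  forall x, `|secant_model P c h x - secant_model P c' h' x| <=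
    gammaF P K * (`|c - c'| * `|x - h| + `|h - h'| * `|x - c'|).
Proof.
move=> Kc Kh Kc' Kh' x.
have d0 : 0 <= `|c - c'| * `|x - h| + `|h - h'| * `|x - c'| by rewrite addr_ge0 // mulr_ge0.
apply: rV_norm_le => [|i]; first by rewrite mulr_ge0 // gammaF_ge0.
have /program_estimates[_ _ _ _ Mdist] : (size P + i < n + size P)%N.
  by rewrite addnC ltn_add2r.
rewrite rV_subE !secant_model_entry.
apply: le_trans (Mdist _ _ _ _ Kc Kh Kc' Kh' x) _.
by rewrite ler_wpM2r // (le_bigmax _ (fun i : 'I_n => gamma (size P + i))).
Qed.

End Estimates.
End Model.

(** * Zeros of perturbed maps *)

Lemma nearest_exists (R : realType) n (A : set 'rV[R]_n) p :
  closed A -> A !=set0 -> nearest A p !=set0.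
Proof.
move=> Acl [z0 Az0].
pose B := [set x : 'rV[R]_n | `|x - p| <= `|z0 - p|].
have cAB : compact (B `&` A) by exact: compact_closedI (@closed_ball_compact R n _ _) Acl.
have [|x /[!inE] -[Bx Ax] xmin] := @compact_EVT_min _ R _ (B `&` A) _ cAB
    (continuous_subspaceT (@dist_continuous R _ p)).
  by exists z0; split => //; rewrite /B /=.
exists x; split=> // z Az; have [zz0|/ltW z0z] := leP `|z - p| `|z0 - p|.
  by apply: xmin; rewrite inE.
exact: le_trans Bx z0z.
Qed.

Section Perturbation.
Context {R : realType} {n : nat}.
(** [G] stands for the tangent model at the root [xs], [H] for a model whose base points have
    distances [a] and [b] from [xs]. *)
Variables (G H : 'rV[R]_n -> 'rV[R]_n) (xs : 'rV[R]_n) (r c gamma L LH a b : R).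
Hypothesis r0 : 0 < r.
Hypothesis c0 : 0 < c.
Hypothesis L0 : 0 < L.
Hypothesis gamma0 : 0 <= gamma.
Hypothesis cgr : c * gamma * r <= 1.
Hypothesis G_lip : forall x y, `|G x - G y| <= L * `|x - y|.
Hypothesis H_lip : forall x y, `|H x - H y| <= LH * `|x - y|.
Hypothesis G_inv : forall x y, `|x - xs| < r -> `|y - xs| < r ->
  `|x - y| <= c * `|G x - G y|.
Hypothesis G_xs : G xs = 0.
Hypothesis a0 : 0 <= a.
Hypothesis ar : a < r / 3.
Hypothesis b0 : 0 <= b.
Hypothesis br : b < r / 3.
Hypothesis H_dist : forall x,
  `|H x - G x| <= gamma * (a * (`|x - xs| + b) + b * `|x - xs|).

Lemma perturbed_zero_close x : `|x - xs| < r -> H x = 0 ->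
  `|x - xs| <= 3 * a / r * b.
Proof.
move=> xr Hx; have xsr : `|xs - xs| < r by rewrite subrr normr0.
have := G_inv xr xsr; rewrite G_xs subr0 => xc.
have := H_dist x; rewrite Hx sub0r normrN => Gx.
set e := `|x - xs| in xr xc Gx *.
have e0 : 0 <= e by exact: normr_ge0.
have k0 : 0 <= c * gamma by rewrite mulr_ge0 // ltW.
have ek : e <= c * gamma * (a * (e + b) + b * e).
  by rewrite -mulrA; apply: le_trans xc _; rewrite ler_pM2l.
have s0 : 0 <= a * (e + b) + b * e by rewrite addr_ge0 ?mulr_ge0 ?addr_ge0.
have er : e * r <= a * (e + b) + b * e.
  apply: (@le_trans _ _ (c * gamma * r * (a * (e + b) + b * e))).
    by rewrite mulrAC ler_pM2r.
  by rewrite ler_piMl.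
rewrite mulrAC ler_pdivlMr //.
have : e * (a + b) <= e * (2 * (r / 3)) by rewrite ler_wpM2l //; move: ar br; lra.
lra.
Qed.

Lemma perturbed_zero_exists : exists2 z, `|z - xs| <= r / 3 & H z = 0.
Proof.
pose D := [set x : 'rV[R]_n | `|x - xs| < r].
have Dxs : D xs by rewrite /D /= subrr normr0.
have [E [E_lip EG]] := lipschitz_left_inverse (ltW c0) (ex_intro D xs Dxs) G_inv.
have E0 : E 0 = xs by rewrite -G_xs EG.
have tau0 : 0 < r / 3 / c by rewrite !divr_gt0.
have r3 : r / 3 < r by move: r0; lra.
have Exs y : `|y - 0| <= r / 3 / c -> `|E y - xs| <= r / 3.
  rewrite ler_pdivlMr // mulrC -E0 => yc; exact: le_trans (E_lip y 0) yc.
have GE y : `|y - 0| <= r / 3 / c -> G (E y) = y.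
  rewrite ler_pdivlMr // mulrC subr0 => yc.
  have [x Dx Gx] := bilipschitz_surj c0 L0 G_lip G_inv G_xs (le_lt_trans yc r3).
  by rewrite -Gx EG.
have [||y yt Hy] := @near_id_zero R n 0 (r / 3 / c) (H \o E) tau0.
- have Hc : continuous H by exact: lipschitz_continuous H_lip.
  have Ec : continuous E by exact: lipschitz_continuous E_lip.
  by move=> y; apply: continuous_comp; [exact: Ec|exact: Hc].
- move=> y yt; rewrite subr0 -{2}(GE y yt) /=.
  apply: le_trans (H_dist _) _; have := Exs y yt; set e := `|_| => er.
  have e0 : 0 <= e by exact: normr_ge0.
  rewrite ler_pdivlMr //.
  (* Three products of numbers at most [r / 3]; with [c * gamma * r <= 1] the deviation of [H \o E]
     from the identity is at most [r / 3 / c], exactly the radius of the ball in the image. *)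
  have sr : a * (e + b) + b * e <= r * (r / 3).
    have h1 : a * (e + b) <= r / 3 * (r / 3 + r / 3) 
      by apply: ler_pM; rewrite ?addr_ge0 ?(ltW ar) // lerD // ltW.
    have h2 : b * e <= r / 3 * (r / 3) by apply: ler_pM; rewrite // ltW.
    lra.
  rewrite mulrAC (mulrC gamma).
  have k0 : 0 <= c * gamma by rewrite mulr_ge0 // ltW.
  apply: le_trans (ler_wpM2l k0 sr) _.
  by rewrite !mulrA -mulrA ler_piMl // ltW // divr_gt0.
by exists (E y) => //; exact: Exs.
Qed.

Lemma zeros_closed : closed (zeros H).
Proof.
rewrite (_ : zeros H = (fun x => `|H x|) @^-1` [set t | t <= 0]).
  apply: closed_comp; last exact: closed_le.
  move=> x _; apply: (@lipschitz_continuous _ _ _ LH) => y z.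
  exact: le_trans (ler_dist_dist _ _) (H_lip _ _).
by apply/seteqP; split=> x /=; rewrite /zeros /= normr_le0 => /eqP.
Qed.

Lemma newton_step p : `|p - xs| < r / 3 ->
  [/\ zeros H !=set0, nearest (zeros H) p !=set0 &
      forall x, nearest (zeros H) p x -> `|x - xs| <= 3 * a / r * b].
Proof.
move=> pr; have [z zr Hz] := perturbed_zero_exists.
have Z0 : zeros H !=set0 by exists z.
split=> //; first exact: nearest_exists zeros_closed Z0.
(* The root [z] within [r / 3] of [xs] is less than [2 * r / 3] from [p], so the nearest root is
   too, and hence lies within [r] of [xs]. *)
move=> x [Hx /(_ z Hz) xz]; apply: perturbed_zero_close => //.
have := ler_distD p x xs; have := ler_distD xs z p; rewrite (distrC xs); move: pr; lra.
Qed.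

End Perturbation.

(** * Local linear convergence of the tangent and secant iterations *)

Unset Implicit Arguments.
Set Strict Implicit.

Theorem corollary4p4 (R : realType) (n : nat)
    (Omega : set 'rV[R]_n) (F : 'rV[R]_n -> 'rV[R]_n) (P : seq (instr R))
    (xs : 'rV[R]_n) (Rbar c gamma r : R)
    (Omega_open : open Omega)
    (F_eval : evaluation_procedure P Omega F)
    (xs_isolated : isolated [set x | Omega x /\ F x = 0] xs)
    (Rbar_gt0 : 0 < Rbar)
    (D_sub : ball xs Rbar `<=` Omega)
    (model_bij : bijection_onto_image (tangent_model P xs) (ball xs Rbar))
    (c_gt0 : 0 < c)
    (model_reg : metric_regular (tangent_model P xs) (ball xs Rbar) c)
    (gamma_valid : second_order_constant P Omega (ball xs Rbar) gamma)
    (r_gt0 : 0 < r)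
    (r_le : (r%:E <= Order.min Rbar%:E
               (if (gamma == 0)%R then +oo else ((c * gamma)^-1)%R%:E))%E) :
  let B := ball xs (r / 3) in
  [/\ forall xm : 'rV[R]_n, B xm ->
        [/\ zeros (tangent_model P xm) !=set0,
            newton_tangent P xm !=set0 & newton_tangent P xm `<=` B],
      forall xc xh : 'rV[R]_n, B xc -> B xh ->
        [/\ zeros (secant_model P xc xh) !=set0,
            newton_secant P xh xc !=set0 & newton_secant P xh xc `<=` B],
      forall u : nat -> 'rV[R]_n, B (u 0%N) ->
        (forall k, newton_tangent P (u k) (u k.+1)) ->
        linearly_convergent u xs &
      forall u : nat -> 'rV[R]_n, B (u 0%N) -> B (u 1%N) ->
        (forall k, newton_secant P (u k.+1) (u k) (u k.+2)) ->
        linearly_convergent (fun k => u k.+1) xs].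
Proof.
have ballE e (x : 'rV[R]_n) : ball xs e x <-> `|x - xs| < e.
  by rewrite -ball_normE /= distrC.
have [wf FP] := F_eval.
have [+ _] := xs_isolated; rewrite inE /= => -[xs_dom F_xs].
have [K [K_convex DK K_Omega K_finite gammaE]] := gamma_valid.
have gamma0 : 0 <= gamma by rewrite gammaE; exact: gammaF_ge0.
have [rR cgr] : r <= Rbar /\ c * gamma * r <= 1.
  move: r_le; rewrite le_min lee_fin => /andP[rR]; have [->|g0] := eqVneq gamma 0.
    by rewrite mulr0 mul0r ler01.
  rewrite lee_fin => rcg; split=> //; rewrite mulrC -ler_pdivlMr ?mul1r //.
  by rewrite mulr_gt0 // lt_neqAle eq_sym g0.
have KB e x : e <= Rbar -> `|x - xs| < e -> K x.
  by move=> eR xe; apply/DK/ballE; exact: lt_le_trans eR.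
have K_xs : K xs by apply: (KB Rbar); rewrite // subrr normr0.
have K_neq0 : K !=set0 by exists xs.
pose G := tangent_model P xs.
have G_xs : G xs = 0.
  by rewrite /G /tangent_model (secant_model_interpolates wf K_convex K_Omega) // -FP.
have G_inv x y : `|x - xs| < r -> `|y - xs| < r -> `|x - y| <= c * `|G x - G y|.
  move=> /lt_le_trans/(_ rR)/ballE Dx /lt_le_trans/(_ rR)/ballE Dy.
  (* At the value [G y] the inverse returns [y], so metric regularity becomes a lower Lipschitz
     bound for [G]. *)
  have := model_reg x (G y) Dx (ex_intro2 _ _ y Dy erefl).
  have [_ inj _] := model_bij.
  by rewrite (pinvKV _ inj) // inE.
have G_lip := secant_model_lipschitz wf K_convex K_Omega K_finite K_neq0 K_xs K_xs.
set L := \big[_/_]_(_ < _) _ in G_lip.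
have L0 : 0 < L by apply: lt_le_trans (bigmax_ge_id _ _ _ _); exact: ltr01.
have r3R : r / 3 <= Rbar by lra.
(* Both modes at once, the tangent mode being [xc = xh]. In the secant iteration [xc] is the older
   point: its error gives the factor, and the error of the newer [xh] is contracted. *)
have step xc xh p : `|xc - xs| < r / 3 -> `|xh - xs| < r / 3 -> `|p - xs| < r / 3 ->
    [/\ zeros (secant_model P xc xh) !=set0,
        nearest (zeros (secant_model P xc xh)) p !=set0 &
        forall x, nearest (zeros (secant_model P xc xh)) p x ->
          `|x - xs| <= 3 * `|xc - xs| / r * `|xh - xs|].
  move=> xcr xhr pr; have Kc := KB _ _ r3R xcr; have Kh := KB _ _ r3R xhr.
  have H_lip := secant_model_lipschitz wf K_convex K_Omega K_finite K_neq0 Kc Kh.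
  have H_dist x : `|secant_model P xc xh x - G x| <=
      gamma * (`|xc - xs| * (`|x - xs| + `|xh - xs|) + `|xh - xs| * `|x - xs|).
    rewrite gammaE.
    apply: le_trans (secant_model_dist wf K_convex K_Omega K_finite K_neq0 Kc Kh K_xs K_xs x) _.
    rewrite ler_wpM2l ?gammaF_ge0 // lerD2r ler_wpM2l //.
    by rewrite (distrC xh) ler_distD.
  exact: (@newton_step R n G (secant_model P xc xh) xs r c gamma L L _ _
    r_gt0 c_gt0 L0 gamma0 cgr G_lip H_lip G_inv G_xs
    (normr_ge0 _) xcr (normr_ge0 _) xhr H_dist p pr).
have mid xc xh : `|xc - xs| < r / 3 -> `|xh - xs| < r / 3 ->
    `|2^-1 *: (xh + xc) - xs| < r / 3.
  move=> xcr xhr.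
  have -> : 2^-1 *: (xh + xc) - xs = 2^-1 *: ((xh - xs) + (xc - xs)).
    by apply/rowP => i; rewrite !mxE; lra.
  rewrite normrZ gtr0_norm ?invr_gt0 //.
  have := ler_normD (xh - xs) (xc - xs); lra.
have factor_lt a : a < r / 3 -> 3 * a / r < 1.
  by move=> ar; rewrite ltr_pdivrMr // mul1r; lra.
have contract a b : 0 <= b -> a < r / 3 -> 3 * a / r * b <= b.
  by move=> b0 ar; rewrite ler_piMl // ltW // factor_lt.
have tangent_mid (xm : 'rV[R]_n) : 2^-1 *: (xm + xm) = xm.
  by apply/rowP => i; rewrite !mxE; lra.
have newton_tangentE (xm : 'rV[R]_n) : newton_tangent P xm = newton_secant P xm xm.
  by rewrite /newton_secant tangent_mid.
have secant_step (xc xh : 'rV[R]_n) : ball xs (r / 3) xc -> ball xs (r / 3) xh ->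
    [/\ zeros (secant_model P xc xh) !=set0,
        newton_secant P xh xc !=set0 & newton_secant P xh xc `<=` ball xs (r / 3)].
  move=> /ballE xcr /ballE xhr.
  have [Z0 N0 Nle] := step xc xh _ xcr xhr (mid _ _ xcr xhr).
  split=> // x /Nle xle; apply/ballE; apply: le_lt_trans xle _.
  exact: le_lt_trans (contract _ _ _ xcr) xhr.
have conv (x y : nat -> 'rV[R]_n) a : a < r / 3 -> (forall k, `|y k - xs| <= a) ->
    (forall k, `|x k.+1 - xs| <= 3 * `|y k - xs| / r * `|x k - xs|) ->
    linearly_convergent x xs.
  (* The alternative 1/2 keeps the rate positive when [a = 0]. *)
  move=> ar ya xy; exists (Num.max 2^-1 (3 * a / r)); split=> [|k].
    rewrite lt_max invr_gt0 ltr0n /= gt_max factor_lt // andbT.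
    by rewrite invf_lt1 // ltr1n.
  apply: le_trans (xy k) _; rewrite ler_wpM2r // le_max; apply/orP; right.
  by rewrite ler_pM2r ?invr_gt0 // ler_pM2l.
have tangent_step (xm : 'rV[R]_n) : ball xs (r / 3) xm ->
    [/\ zeros (tangent_model P xm) !=set0,
        newton_tangent P xm !=set0 & newton_tangent P xm `<=` ball xs (r / 3)].
  by move=> xmr; rewrite newton_tangentE; exact: secant_step.
split=> // u.
- move=> /ballE u0 uN.
  have contr k : `|u k - xs| < r / 3 ->
      `|u k.+1 - xs| <= 3 * `|u k - xs| / r * `|u k - xs|.
    by move=> ukr; have [_ _ near] := step _ _ _ ukr ukr ukr; exact: near (uN k).
  (* Errors never exceed the initial one, which gives a factor below 1 uniform in [k]. *)
  have ua k : `|u k - xs| <= `|u 0%N - xs|.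
    elim: k => // k uka; have ukr := le_lt_trans uka u0.
    exact: le_trans (contr k ukr) (le_trans (contract _ _ _ ukr) uka).
  by apply: (conv u u _ u0 ua) => k; apply: contr; exact: le_lt_trans u0.
move=> /ballE u0 /ballE u1 uN.
(* Each step uses two errors, so the invariant bounds two consecutive ones by the larger starting
   error. *)
pose a := Num.max `|u 0%N - xs| `|u 1%N - xs|.
have ar : a < r / 3 by rewrite gt_max u0.
have contr k : `|u k - xs| < r / 3 -> `|u k.+1 - xs| < r / 3 ->
    `|u k.+2 - xs| <= 3 * `|u k - xs| / r * `|u k.+1 - xs|.
  by move=> ukr uk1r; have [_ _ near] := step _ _ _ ukr uk1r (mid _ _ ukr uk1r); exact: near (uN k).
have ua k : `|u k - xs| <= a /\ `|u k.+1 - xs| <= a.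
  elim: k => [|k [uka uk1a]]; first by rewrite /a !le_max !lexx orbT.
  have ukr := le_lt_trans uka ar; have uk1r := le_lt_trans uk1a ar.
  by split=> //; apply: le_trans (contr k ukr uk1r) (le_trans (contract _ _ _ ukr) uk1a).
apply: (conv _ u a ar) => k; have [uka uk1a] := ua k => //.
by apply: contr; exact: le_lt_trans ar.
Qed.
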